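(* Let $G$ be a locally finite, connected, infinite graph and let $\Gamma\subset\mathrm{Aut}(G)$ be a closed nonunimodular subgroup that acts transitively on $G$. Let $x\in V(G)$, let $T_x$ be the tree containing $x$ in the wired uniform spanning forest on $G$, and let $\lambda\in\mathbb{R}$. If $\lambda\le 0$, then $|T_x|_{x,\lambda}=\infty$ almost surely. If $\lambda>0$, then $|T_x|_{x,\lambda}<\infty$ almost surely.
   Context: For $x\in V(G)$, $m(x)=|\Gamma_x|$ is the left Haar measure of the stabilizer $\Gamma_x$ of $x$ in $\Gamma$, and $\Delta(x,y)=m(y)/m(x)$. For $K\subset V(G)$ (or a subgraph with vertex set $K$), $v\in K$ and $\lambda\in\mathbb{R}$, the tilted volume is $|K|_{v,\lambda}=\sum_{y\in K}\Delta(v,y)^\lambda$. Wired uniform spanning forest (WUSF): let $V_n\uparrow V(G)$ be finite sets such that the induced subgraphs $G_n$ are connected; let $G_n^W$ be obtained from $G$ by identifying all vertices outside $V_n$ to a single vertex and deleting the resulting loops (keeping multiple edges). The WUSF is the weak limit of the uniform spanning tree measures on $G_n^W$. *)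

(* Defs.v *)
From HB Require Import structures.
From mathcomp Require Import all_boot all_order all_algebra.
From mathcomp Require Import finmap.
From mathcomp Require Import all_classical all_reals all_analysis.

Set Implicit Arguments.
Unset Strict Implicit.
Unset Printing Implicit Defensive.

Import Order.TTheory GRing.Theory Num.Theory.
Import numFieldNormedType.Exports.

Local Open Scope classical_set_scope.
Local Open Scope ring_scope.

Notation borel T := (g_sigma_algebraType (@open T)).

#[short(type="ptgroupType")]
HB.structure Definition PointedTopologicalGroup :=
  {T of Group T & PointedTopological T}.

Section haar.
Variables (R : realType) (T : ptgroupType).
Implicit Type mu : {measure set (borel T) -> \bar R}.

Definition left_invariant mu : Prop := forall (g : T) (A : set (borel T)),
  measurable A -> mu [set (g * h)%g | h in A] = mu A.

Definition right_invariant mu : Prop := forall (g : T) (A : set (borel T)),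
  measurable A -> mu [set (h * g)%g | h in A] = mu A.

Definition radon mu : Prop :=
  [/\ forall K : set T, compact K -> (mu K < +oo)%E,
      forall A : set (borel T), measurable A ->
        mu A = ereal_inf [set mu U | U in [set U | open U /\ A `<=` U]] &
      forall U : set T, open U ->
        mu U = ereal_sup [set mu K | K in [set K | compact K /\ K `<=` U]]].

Definition left_haar mu : Prop :=
  [/\ radon mu, left_invariant mu & mu setT != 0%E].

(* Left Haar measures on [T] are proportional to each other, so the quantifier
   over [mu] is immaterial. *)
Definition unimodular : Prop := forall mu, left_haar mu -> right_invariant mu.

End haar.
Arguments unimodular R T : clear implicits.

(* [mends M e u v]: the edge [e] joins [u] and [v]; parallel edges and loops are
   allowed.  Only the vertices in [mverts M] and the edges in [medges M] belong
   to the multigraph. *)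
Record multigraph (W E : Type) := Multigraph {
  mverts : set W;
  medges : set E;
  mends : E -> W -> W -> Prop }.

Section multigraph.
Variables (W : eqType) (E : eqType).
Implicit Types (M : multigraph W E) (A : set E).

(* [p] lists the successive edges of the walk, each with the vertex it leads to *)
Fixpoint walk M A (u : W) (p : seq (E * W)) (v : W) : Prop :=
  if p is (e, w) :: p' then [/\ A e, mends M e u w & walk M A w p' v]
  else u = v.

Definition joined M A (u v : W) : Prop := exists p, walk M A u p v.

(* The edges must be distinct too, so that going back and forth along one edge
   is not a cycle whereas two parallel edges, or a loop, form one. *)
Definition cycle_in M A : Prop := exists u p,
  [/\ p != [::], walk M A u p u, uniq (unzip1 p) & uniq (unzip2 p)].

Definition spanning_tree M A : Prop :=
  [/\ A `<=` medges M,
      forall u v, mverts M u -> mverts M v -> joined M A u v &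
      ~ cycle_in M A].

End multigraph.

Record sgraph (V : Type) := SGraph {
  adj :> V -> V -> Prop;
  adj_sym : forall u v, adj u v -> adj v u;
  adj_irr : forall u, ~ adj u u }.

Section graph.
Variables (V : choiceType) (G : sgraph V).

Definition edges : set {fset V} :=
  [set e | exists u v, adj G u v /\ e = [fset u; v]%fset].

Definition edge : choiceType := set_type edges.

Definition to_multigraph : multigraph V edge := {|
  mverts := setT;
  medges := setT;
  mends := fun e u v => val e = [fset u; v]%fset |}.

Definition locally_finite : Prop := forall u, finite_set [set v | adj G u v].

Definition connected_graph : Prop := forall u v, joined to_multigraph setT u v.

Definition connected_induced (S : {fset V}) : Prop :=
  forall u v, u \in S -> v \in S ->
    joined to_multigraph [set e | (val e `<=` S)%fset] u v.

Definition automorphisms : set {ptws V -> discrete_topology V} :=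
  [set g | bijective g /\ forall u v, adj G (g u) (g v) <-> adj G u v].

Definition aut : Type := set_type automorphisms.

HB.instance Definition _ := Topological.copy aut (set_type automorphisms).
HB.instance Definition _ := SubType.copy aut (set_type automorphisms).

Definition aut_fun (g : aut) : V -> V := val g.

Lemma aut_inj (g h : aut) : aut_fun g =1 aut_fun h -> g = h.
Proof. by move=> gh; apply: val_inj; apply/funext. Qed.

Lemma aut_one_subproof : (id : {ptws V -> discrete_topology V}) \in automorphisms.
Proof. by apply/mem_set; split=> //; exists id. Qed.

Definition aut_one : aut := SigSub aut_one_subproof.

Lemma aut_mul_subproof (g h : aut) :
  (aut_fun g \o aut_fun h : {ptws V -> discrete_topology V}) \in automorphisms.
Proof.
have [gb ga] := set_mem (valP g); have [hb ha] := set_mem (valP h).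
by apply/mem_set; split=> [|u v]; [exact: bij_comp | rewrite /= ga ha].
Qed.

Definition aut_mul (g h : aut) : aut := SigSub (aut_mul_subproof g h).

Lemma aut_inv_subproof (g : aut) : exists h : aut,
  cancel (aut_fun g) (aut_fun h) /\ cancel (aut_fun h) (aut_fun g).
Proof.
have [[h gK hK] ga] := set_mem (valP g).
have hP : (h : {ptws V -> discrete_topology V}) \in automorphisms.
  apply/mem_set; split=> [|u v]; first by exists (val g).
  by rewrite -ga !hK.
by exists (SigSub hP).
Qed.

Definition aut_inv (g : aut) : aut := sval (cid (aut_inv_subproof g)).

Lemma aut_mulA : associative aut_mul.
Proof. by move=> g h k; apply: aut_inj. Qed.
Lemma aut_mul1 : left_id aut_one aut_mul.
Proof. by move=> g; apply: aut_inj. Qed.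
Lemma aut_1mul : right_id aut_one aut_mul.
Proof. by move=> g; apply: aut_inj. Qed.
Lemma aut_mulV : left_inverse aut_one aut_inv aut_mul.
Proof.
by move=> g; apply: aut_inj => v; rewrite /aut_inv; case: cid => h [/= + _]; apply.
Qed.
Lemma aut_Vmul : right_inverse aut_one aut_inv aut_mul.
Proof.
by move=> g; apply: aut_inj => v; rewrite /aut_inv; case: cid => h [/= _]; apply.
Qed.

HB.instance Definition _ :=
  isGroup.Build aut aut_mulA aut_mul1 aut_1mul aut_mulV aut_Vmul.

Record closed_subgroup := ClosedSubgroup {
  csg_set :> set aut;
  csg_group : group_closed (fun g : aut => g \in csg_set);
  csg_closed : closed csg_set }.

Section closed_subgroup.
Variable Gamma : closed_subgroup.

Definition csg : Type := set_type Gamma.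

HB.instance Definition _ := Topological.copy csg (set_type Gamma).
HB.instance Definition _ := SubChoice.copy csg (set_type Gamma).
HB.instance Definition _ :=
  SubChoice_isSubGroup.Build aut (fun g => g \in csg_set Gamma) csg
    (csg_group Gamma).
HB.instance Definition _ := isPointed.Build csg 1%g.

Definition act (g : csg) : V -> V := aut_fun (val g).

Definition transitive_on_vertices : Prop := forall x y, exists g, act g x = y.

Definition stabilizer (x : V) : set csg := [set g | act g x = x].

End closed_subgroup.

(* [G^W_S]: the vertices outside [S] are identified to [None], and the edges
   that become loops (those with no endpoint in [S]) are deleted *)
Definition contract (S : {fset V}) (v : V) : option V :=
  if v \in S then Some v else None.

Definition wired_ends (S : {fset V}) (e : edge) (a b : option V) : Prop :=
  exists u v,
    [/\ val e = [fset u; v]%fset, a = contract S u & b = contract S v].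

Definition wired (S : {fset V}) : multigraph (option V) edge := {|
  mverts := range (contract S);
  medges := [set e | ~ exists a, wired_ends S e a a];
  mends := wired_ends S |}.

Definition config : Type := {ptws edge -> bool}.
HB.instance Definition _ := Topological.copy config {ptws edge -> bool}.
HB.instance Definition _ := isPointed.Build config (fun=> false).

Definition edge_set (w : config) : set edge := [set e | w e].

Definition spanning_trees (S : {fset V}) : set config :=
  [set w | spanning_tree (wired S) (edge_set w)].

Definition exhaustion (V_ : nat -> {fset V}) : Prop :=
  [/\ forall n, (V_ n `<=` V_ n.+1)%fset,
      forall v, exists n, v \in V_ n &
      forall n, connected_induced (V_ n)].

(* expectation under the uniform measure on the spanning trees of [G^W_S], which
   are finitely many when [G] is locally finite *)
Definition ust_mean (R : realType) (S : {fset V}) (f : config -> R) : R :=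
  (\sum_(w <- fset_set (spanning_trees S)) f w) /
  #|` fset_set (spanning_trees S)|%:R.

(* The limit exists and does not depend on the exhaustion, so quantifying
   existentially over exhaustions singles out one law. *)
Definition wusf (R : realType) (P : probability (borel config) R) : Prop :=
  exists2 V_ : nat -> {fset V}, exhaustion V_ &
    forall f : config -> R, continuous f -> bounded_fun f ->
      (fun n => ust_mean (V_ n) f) @ \oo --> Rintegral P setT f.

Definition tree_containing (w : config) (x : V) : set V :=
  [set y | joined to_multigraph (edge_set w) x y].

End graph.

Section tilted_volume.
Variables (R : realType) (V : choiceType) (G : sgraph V).
Variables (Gamma : closed_subgroup G).
Variable mu : {measure set (borel (csg Gamma)) -> \bar R}.

Definition Delta (x y : V) : R :=
  fine (mu (@stabilizer _ _ Gamma y)) / fine (mu (@stabilizer _ _ Gamma x)).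

Definition tilted_volume (K : set V) (v : V) (lambda : R) : \bar R :=
  (\esum_(y in K) ((Delta v y) `^ lambda)%:E)%E.

End tilted_volume.

(* Main.v *)
Require Import Defs.
From mathcomp Require Import all_boot all_order all_algebra.
From mathcomp Require Import finmap.
From mathcomp Require Import all_classical all_reals all_analysis.
From mathcomp Require Import measurable_realfun.

(** Let [m x] be the Haar measure of the stabilizer of [x].  Computing the
    measure of [{g | g x ~ x}] in two ways shows that [m] is harmonic, so by a
    strict Young inequality and nonunimodularity [m ^ s], for [0 < s < 1], is an
    eigenfunction of the adjacency operator for an eigenvalue [d - kappa] with
    [kappa > 0], where [d] is the degree.

    A spanning tree of a wired graph amounts to the function sending each vertex
    to the next one on its path to the boundary.  Exchanging the outgoing edge of
    [v] for another one is an involution on pairs (tree, neighbour of [v]).  It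
    shows that the number [a x z] of trees in which [x] leads to [z] is
    subharmonic in [x != z], and that the number [c x y] of trees in which the
    paths of [x] and [y] meet before the boundary satisfies
    [d * c x y <= \sum_(y' ~ y) c x y' + d * a x y].  Pairing both inequalities with
    the eigenfunction bounds the mean [s]-tilted volume of the component of [x]
    by [(d / kappa) ^ 2], uniformly in the finite volume.  In the limit the
    [s]-tilted volume is almost surely finite, hence so are those of larger
    exponent.  The tree is also almost surely infinite, and [Delta x] is bounded
    on it, so the tilted volumes with nonpositive exponent diverge. *)

Set Implicit Arguments.
Unset Strict Implicit.
Unset Printing Implicit Defensive.

Import Order.TTheory GRing.Theory Num.Theory.
Import numFieldNormedType.Exports.

(** * Rooted spanning forests of a finite graph *)

Section rooted_forests.
Variables (U : finType) (S : {pred U}) (e : rel U).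
Implicit Types (f : {ffun U -> U}) (u v x y z : U).

(* [f v] is the next vertex on the path from [v] to the complement of [S]; a
   forest fixes that complement pointwise, which makes it unique as a function. *)
Definition forest : {set {ffun U -> U}} := [set f : {ffun U -> U} |
  [forall v, if v \in S then e v (f v) && [exists u, (u \notin S) && fconnect f v u]
             else f v == v]].

Lemma forestP f : reflect
  [/\ forall v, v \in S -> e v (f v), forall v, v \notin S -> f v = v &
      forall v, v \in S -> exists2 u, u \notin S & fconnect f v u] (f \in forest).
Proof.
rewrite inE; apply: (iffP forallP) => [H|[H1 H2 H3] v].
  split=> v vS; move: (H v); first by rewrite vS => /andP[].
    by rewrite (negPf vS) => /eqP.
  by rewrite vS => /andP[_ /existsP[u /andP[uS vu]]]; exists u.
case: ifPn => vS; last by rewrite H2.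
rewrite H1 //=; have [u uS vu] := H3 v vS.
by apply/existsP; exists u; rewrite uS.
Qed.

Lemma reachP f u v : reflect (exists n, iter n f u = v) (fconnect f u v).
Proof.
apply: (iffP idP) => [uv|[n <-]]; last exact: fconnect_iter.
by exists (findex f u v); exact: iter_findex.
Qed.

Lemma reach_step f u v : u != v -> fconnect f u v -> fconnect f (f u) v.
Proof.
move=> uv /reachP[[|n] nuv]; first by rewrite -nuv eqxx in uv.
by apply/reachP; exists n; rewrite -iterSr.
Qed.

(** A return to [v] would recur forever, whereas the path from [v] ends at a fixed point outside
    [S]. *)
Lemma forest_acyclic f v : f \in forest -> v \in S -> ~~ fconnect f (f v) v.
Proof.
move=> /forestP[_ fS fr] vS; apply/negP => /reachP[k]; rewrite -iterSr => kv.
have [u uS /reachP[n nu]] := fr v vS.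
have cyc j : iter (j * k.+1) f v = v.
  by elim: j => // j IH; rewrite mulSn iterD IH.
have fixu j : iter j f u = u by elim: j => //= j ->; exact: fS.
(* The fixed point [u] reached after [n] steps is still there after [n * k.+1] steps, when the orbit
   is back at [v]. *)
move: (cyc n); rewrite mulnS addnC iterD nu fixu => uv.
by rewrite uv vS in uS.
Qed.

Definition redirect f v v' : {ffun U -> U} := [ffun u => if u == v then v' else f u].

(** The path from [a] avoids [v], the only vertex where the two functions may differ. *)
Lemma reach_redirect f v v' a b :
  ~~ fconnect f a v -> fconnect (redirect f v v') a b = fconnect f a b.
Proof.
move=> av; have it n : iter n (redirect f v v') a = iter n f a.
  elim: n => //= n ->; rewrite ffunE; case: eqP => // nv.
  by rewrite -nv fconnect_iter in av.
by apply/reachP/reachP => -[n <-]; exists n; rewrite it.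
Qed.

(** The path from [v'] avoids [v] and so survives the redirection; [v] now follows it, and every
    other vertex either keeps its path or reaches [v]. *)
Lemma redirect_forest f v v' : f \in forest -> v \in S -> e v v' ->
  ~~ fconnect f v' v -> redirect f v v' \in forest.
Proof.
move=> ff vS vv' v'v; have [f1 f2 f3] := forestP _ ff.
apply/forestP; split=> [u uS|u uS|u uS]; rewrite ?ffunE.
- by case: eqP => [->//|_]; exact: f1.
- by case: eqP => [uv|_]; [rewrite uv vS in uS | exact: f2].
have rv' : exists2 z, z \notin S & fconnect (redirect f v v') v' z.
  have [v'S|v'S] := boolP (v' \in S); last by exists v'.
  by have [z zS ?] := f3 v' v'S; exists z => //; rewrite reach_redirect.
have rv : exists2 z, z \notin S & fconnect (redirect f v v') v z.
  have [z zS ?] := rv'; exists z => //; apply: connect_trans (_ : fconnect _ v' z) => //.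
  by apply: connect1; rewrite /= ffunE eqxx.
have [uv|uv] := boolP (fconnect f u v); last first.
  by have [z zS ?] := f3 u uS; exists z => //; rewrite reach_redirect.
have [z zS ?] := rv; exists z => //; apply: connect_trans (_ : fconnect _ v z) => //.
have /reachP[n] := uv; elim: n u {uS uv} => [|n IH] u; first by move=> /= ->.
rewrite iterSr => /IH; have [->//|uv] := eqVneq u v.
by apply: connect_trans; apply: connect1; rewrite /= ffunE (negPf uv).
Qed.

(* Restricted to the pairs [(f, u)] with [f] a forest and [u] a neighbour of [v],
   this is an involution: the outgoing edge of [v] is exchanged for [u], unless
   that would close a cycle. *)
Definition swap v (q : {ffun U -> U} * U) : {ffun U -> U} * U :=
  if fconnect q.1 q.2 v then q else (redirect q.1 v q.2, q.1 v).

(** Each branch is injective, and their images are disjoint: by acyclicity, the second component of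
    a redirected pair does not lead to [v]. *)
Lemma swap_inj v q1 q2 : v \in S -> q1.1 \in forest -> q2.1 \in forest ->
  swap v q1 = swap v q2 -> q1 = q2.
Proof.
move=> vS; have mixed f1 v1 f2 v2 : f1 \in forest -> f2 \in forest ->
    fconnect f1 v1 v -> ~~ fconnect f2 v2 v ->
    (f1, v1) <> (redirect f2 v v2, f2 v).
  move=> F1 F2 r1 r2 [E1 E2]; move: r1.
  by rewrite E1 E2 reach_redirect ?(negPf (forest_acyclic _ _)) // forest_acyclic.
case: q1 q2 => [f1 v1] [f2 v2]; rewrite /swap /= => F1 F2.
case: ifPn => r1; case: ifPn => r2 // E.
- by case: (mixed _ _ _ _ F1 F2 r1 r2).
- by case: (mixed _ _ _ _ F2 F1 r2 r1).
case: E => /ffunP E Ev; congr (_, _); last by move: (E v); rewrite !ffunE eqxx.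
by apply/ffunP => u; move: (E u); rewrite !ffunE; case: eqP => // ->.
Qed.

Definition coalesce f x y := [exists z, [&& z \in S, fconnect f x z & fconnect f y z]].

Lemma coalesceP f x y :
  reflect (exists z, [/\ z \in S, fconnect f x z & fconnect f y z]) (coalesce f x y).
Proof. by apply: (iffP existsP) => -[z] /and3P; exists z => //; apply/and3P. Qed.

Lemma coalesce_refl f x : x \in S -> coalesce f x x.
Proof. by move=> xS; apply/coalesceP; exists x. Qed.

Lemma coalesce_sym f x y : coalesce f x y -> coalesce f y x.
Proof. by move=> /coalesceP[z [zS xz yz]]; apply/coalesceP; exists z. Qed.

Lemma coalesce_step f x y : y \in S -> f x = y -> coalesce f x y.
Proof.
by move=> yS fxy; apply/coalesceP; exists y; split=> //; apply: connect1; exact/eqP.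
Qed.

(** Both meeting points lie on the path of [y]; the later one is common to all three paths. *)
Lemma coalesce_trans f x y z : coalesce f x y -> coalesce f y z -> coalesce f x z.
Proof.
move=> /coalesceP[a [aS xa ya]] /coalesceP[b [bS yb zb]]; apply/coalesceP.
have /reachP[i ia] := ya; have /reachP[j jb] := yb.
have [ij|/ltnW ji] := leqP i j.
  exists b; split=> //; apply: connect_trans xa _; apply/reachP; exists (j - i).
  by rewrite -ia -iterD subnK.
exists a; split=> //; apply: connect_trans zb _; apply/reachP; exists (i - j).
by rewrite -jb -iterD subnK.
Qed.

(** * Counting forests by exchanging an outgoing edge *)

Local Notation N v := [set u | e v u].
(** These two counts are [a x z] and [c x y] of the introduction. *)
Definition nreach x z := #|[set f in forest | fconnect f x z]|.
Definition ncoalesce x y := #|[set f in forest | coalesce f x y]|.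

Lemma card_pairs v (P : {ffun U -> U} -> U -> bool) :
  #|[set q : {ffun U -> U} * U | q.1 \in forest & e v q.2 && P q.1 q.2]| =
  \sum_(u in N v) #|[set f in forest | P f u]|.
Proof.
rewrite -sum1_card (eq_bigl (fun q => (q.2 \in N v) && (q.1 \in [set f in forest | P f q.2]))).
  rewrite (eq_bigr (fun u => \sum_(f in [set f in forest | P f u]) 1)); last first.
    by move=> u _; rewrite sum1_card.
  rewrite (exchange_big_dep xpredT) //= pair_big_dep /=.
  by apply: eq_bigl => -[f u]; rewrite !inE /=.
move=> q; apply/setIdP/andP => [[ff /andP[vu Pq]]|[]].
  by split; [rewrite inE | apply/setIdP].
by rewrite inE => -> /setIdP[-> ->].
Qed.

(** Both sums count pairs of a forest and a neighbour of [v]. The hypotheses say that [swap v],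
    injective on such pairs, carries [P] to [Q] on each of its two branches. *)
Lemma swap_card v (P Q : {ffun U -> U} -> U -> bool) : v \in S ->
  (forall f u, f \in forest -> e v u -> P f u -> fconnect f u v -> Q f u) ->
  (forall f u, f \in forest -> e v u -> P f u -> ~~ fconnect f u v ->
     Q (redirect f v u) (f v)) ->
  \sum_(u in N v) #|[set f in forest | P f u]| <=
  \sum_(u in N v) #|[set f in forest | Q f u]|.
Proof.
move=> vS PQ PQ'; rewrite -!card_pairs.
set A := (X in #|pred_of_set X| <= _).
have injA : {in A &, injective (swap v)}.
  move=> q1 q2 /setIdP[F1 _] /setIdP[F2 _].
  by apply: swap_inj.
rewrite -(card_in_imset injA); apply: subset_leq_card;
  apply/fintype.subsetP => _ /imsetP[[f u] fuA ->].
case/setIdP: fuA => /= ff /andP[vu Pfu]; apply/setIdP; rewrite /swap /=.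
case: ifPn => r /=; first by rewrite ff vu PQ.
rewrite redirect_forest //= PQ' // andbT; split=> //.
by case: (forestP _ ff) => fe _ _; exact: fe.
Qed.

(** Swap at [x]: either the neighbour leads to [x] and thus to [z], or it is exchanged for the old
    [f x], which is on the way to [z] because [x != z]. *)
Lemma nreach_harmonic x z : x \in S -> x != z ->
  #|N x| * nreach x z <= \sum_(u in N x) nreach u z.
Proof.
move=> xS xz; rewrite -sum_nat_const.
apply: (swap_card (P := fun f _ => fconnect f x z) (Q := fun f u => fconnect f u z)) => //.
  by move=> f u _ _ xfz ufx; exact: connect_trans xfz.
move=> f u ff _ xfz ufx; rewrite reach_redirect ?forest_acyclic //.
exact: reach_step.
Qed.

(** Forests in which [x] leads to [y] account for the last term. In the others a swap at [y] keeps
    the path of [x], and the neighbour obtained still leads to the meeting point, which is not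
    [y]. *)
Lemma ncoalesce_subharmonic x y : y \in S ->
  #|N y| * ncoalesce x y <= \sum_(u in N y) ncoalesce x u + #|N y| * nreach x y.
Proof.
move=> yS.
have H : #|N y| * #|[set f in forest | coalesce f x y && ~~ fconnect f x y]| <=
         \sum_(u in N y) ncoalesce x u.
  rewrite -sum_nat_const.
  apply: (swap_card (P := fun f _ => coalesce f x y && ~~ fconnect f x y)
                    (Q := fun f u => coalesce f x u)) => //.
    move=> f u _ _ /andP[/coalesceP[z [zS xz yz]] _] uy.
    by apply/coalesceP; exists z; split=> //; exact: connect_trans yz.
  move=> f u ff _ /andP[/coalesceP[z [zS xz yz]] xy] uy.
  have yNz : y != z by apply: contraNneq xy => ->.
  apply/coalesceP; exists z; split; rewrite ?reach_redirect ?forest_acyclic //.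
  exact: reach_step.
apply: leq_trans (leq_add H (leqnn _)); rewrite -mulnDr leq_mul2l; apply/orP; right.
rewrite /ncoalesce /nreach; apply: leq_trans (leq_card_setU _ _).1.
apply: subset_leq_card; apply/fintype.subsetP => f; rewrite !inE => /andP[-> ->] /=.
by case: (fconnect f x y).
Qed.

Lemma nreach_le x z : nreach x z <= #|forest|.
Proof. by apply: subset_leq_card; apply/fintype.subsetP => f; rewrite inE => /andP[]. Qed.

Lemma ncoalesce_out x y : y \notin S -> ncoalesce x y = 0.
Proof.
move=> yS; apply: eq_card0 => f; apply/negP.
move=> /setIdP[/forestP[_ fS _] /coalesceP[z [zS _ /reachP[n yz]]]].
have : iter n f y = y by elim: n {yz} => //= n ->; exact: fS.
by rewrite yz => zy; rewrite -zy zS in yS.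
Qed.

Lemma nreach_out x z : x \notin S -> z \in S -> nreach x z = 0.
Proof.
move=> xS zS; apply: eq_card0 => f; apply/negP => /setIdP[/forestP[_ fS _] /reachP[n xz]].
have : iter n f x = x by elim: n {xz} => //= n ->; exact: fS.
by rewrite xz => zx; rewrite -zx zS in xS.
Qed.

(** * Volume bounds from a positive eigenfunction *)

Local Open Scope ring_scope.
Variables (R : realFieldType) (h : U -> R) (d : nat) (kappa : R).
Hypotheses (e_sym : symmetric e) (h_gt0 : forall u, 0 < h u) (kappa_gt0 : 0 < kappa)
  (degS : {in S, forall v, #|N v| = d})
  (hS : {in S, forall v, \sum_(u in N v) h u = (d%:R - kappa) * h v}).

(** A maximum principle: where the ratio of [A] to [h] is maximal on [S], the inequality [LA] and
    the eigenvalue [d - kappa] bound it by [d / kappa] times the number of forests. *)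
Lemma reach_volume_bound x : x \in S ->
  \sum_(z in S) (nreach x z)%:R * h z <= d%:R / kappa * #|forest|%:R * h x.
Proof.
move=> xS; pose A v := \sum_(z in S) (nreach v z)%:R * h z.
have A_out v : v \notin S -> A v = 0.
  by move=> vS; apply: big1 => z zS; rewrite nreach_out // mul0r.
have LA v : v \in S -> d%:R * A v <= d%:R * #|forest|%:R * h v + \sum_(u in N v) A u.
  move=> vS; rewrite /A exchange_big /= mulr_sumr (bigD1 v) //=.
  rewrite [X in _ <= _ + X](bigD1 v) //= addrA; apply: lerD.
    rewrite mulrA; apply: (@le_trans _ _ (d%:R * #|forest|%:R * h v)).
      by apply: ler_wpM2r; [exact: ltW | rewrite ler_wpM2l ?ler0n // ler_nat nreach_le].
    rewrite lerDl; apply: sumr_ge0 => u _.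
    by rewrite mulr_ge0 ?ler0n // ltW.
  apply: ler_sum => z /andP[zS zv]; rewrite mulrA -mulr_suml.
  apply: ler_wpM2r; first exact: ltW.
  rewrite -natrM -natr_sum ler_nat -(degS vS) nreach_harmonic //.
  by rewrite eq_sym.
have [v vS vmax] : exists2 v, v \in S & forall u, u \in S -> A u / h u <= A v / h v.
  by case: (arg_maxP (fun u => A u / h u) xS) => v vS H; exists v.
have AM u : A u <= A v / h v * h u.
  have [uS|uS] := boolP (u \in S); first by rewrite -ler_pdivrMr ?h_gt0 ?vmax.
  rewrite A_out //; apply: mulr_ge0; last exact: ltW.
  apply: divr_ge0; last exact: ltW.
  by apply: sumr_ge0 => z _; rewrite mulr_ge0 ?ler0n // ltW.
rewrite -ler_pdivrMr ?h_gt0 //; apply: le_trans (vmax x xS) _.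
rewrite mulrAC ler_pdivlMr // -(ler_pM2r (h_gt0 v)).
have hv0 : h v != 0 by rewrite gt_eqF.
rewrite mulrAC -[_ / h v * h v]mulrA mulVf // mulr1.
have sumA : \sum_(u in N v) A u <= (d%:R - kappa) * A v.
  apply: (@le_trans _ _ (\sum_(u in N v) A v / h v * h u)).
    by apply: ler_sum => u _; exact: AM.
  rewrite -mulr_sumr hS // [(d%:R - kappa) * h v]mulrC mulrA -[_ / h v * h v]mulrA.
  by rewrite mulVf // mulr1 mulrC.
have := le_trans (LA v vS) (lerD (lexx _) sumA).
by rewrite mulrBl addrA lerBrDl lerD2r mulrC [A v * _]mulrC ?mulrA.
Qed.

(** Pairing [ncoalesce_subharmonic] with [h] and moving the adjacency operator onto [h] leaves
    [kappa * M] bounded by [d] times the sum in [reach_volume_bound]. *)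
Lemma coalesce_volume_bound x : x \in S ->
  \sum_(y in S) (ncoalesce x y)%:R * h y <= (d%:R / kappa) ^+ 2 * #|forest|%:R * h x.
Proof.
move=> xS.
have step y : y \in S -> d%:R * (ncoalesce x y)%:R * h y <=
    (\sum_(u in N y) (ncoalesce x u)%:R + d%:R * (nreach x y)%:R) * h y :> R.
  move=> yS; apply: ler_wpM2r; first exact: ltW.
  rewrite -natr_sum -!natrM -natrD ler_nat -(degS yS).
  exact: ncoalesce_subharmonic.
(* Since [ncoalesce x] vanishes outside [S], [u] may be kept in [S]; the neighbours of [u] outside
   [S] only enlarge the right side. *)
have dual : \sum_(y in S) (\sum_(u in N y) (ncoalesce x u)%:R) * h y <=
    \sum_(u in S) (ncoalesce x u)%:R * ((d%:R - kappa) * h u) :> R.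
  rewrite (eq_bigr (fun y => \sum_(u in S) (if e y u then (ncoalesce x u)%:R * h y else 0))).
    rewrite exchange_big /=; apply: ler_sum => u uS.
    rewrite -hS // mulr_sumr [leRHS]big_mkcond [leLHS]big_mkcond /=.
    apply: ler_sum => y _; rewrite inE e_sym; do 2 case: ifP => // _.
    by rewrite mulr_ge0 ?ler0n // ltW.
  move=> y yS; rewrite mulr_suml [LHS]big_mkcond [RHS]big_mkcond /=.
  apply: eq_bigr => u _; rewrite inE; case: (boolP (u \in S)) => [//|uS].
  by rewrite ncoalesce_out // mul0r if_same.
set M := \sum_(y in S) (ncoalesce x y)%:R * h y.
have tot : d%:R * M <= (d%:R - kappa) * M + d%:R * (\sum_(y in S) (nreach x y)%:R * h y).
  rewrite /M !mulr_sumr; under eq_bigr => y _ do rewrite mulrA.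
  apply: le_trans (ler_sum _ step) _.
  under eq_bigr => y _ do rewrite mulrDl.
  rewrite big_split /=; apply: lerD.
    by under [leRHS]eq_bigr => y _ do rewrite mulrCA.
  by apply: ler_sum => y _; rewrite mulrA.
have {}tot : kappa * M <= d%:R * (\sum_(y in S) (nreach x y)%:R * h y).
  by rewrite mulrBl addrAC lerBrDr lerD2l in tot.
have := le_trans tot (ler_wpM2l (ler0n _ _) (reach_volume_bound xS)).
rewrite -ler_pdivlMl // => /le_trans; apply.
by rewrite expr2 !mulrA [kappa^-1 * _]mulrC.
Qed.

End rooted_forests.

Local Open Scope classical_set_scope.
Local Open Scope ring_scope.

(** * Spanning trees of the wired graph *)

(* [all_reals] also exports a [contract], for extended reals. *)
Local Notation contract := Defs.contract.

(** * Walks and cycles in a multigraph *)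

Section walks.
Variables (W E : eqType) (M : multigraph W E).
Implicit Types (A B : set E) (u v w : W).

Lemma walk_cat A u p v q w : walk M A u p v -> walk M A v q w -> walk M A u (p ++ q) w.
Proof.
by elim: p u => [|[e x] p IH] u /= => [->//|[Ae ux xv] vw]; split=> //; exact: IH.
Qed.

Lemma walk_last A u p v : walk M A u p v -> last u (unzip2 p) = v.
Proof. by elim: p u => [|[e w] p IH] u //= [_ _ /IH]. Qed.

Lemma joined_trans A u v w : joined M A u v -> joined M A v w -> joined M A u w.
Proof. by move=> [p up] [q vq]; exists (p ++ q); exact: walk_cat vq. Qed.

Lemma joined_refl A u : joined M A u u.
Proof. by exists [::]. Qed.

Lemma joined_edge A e u v : A e -> mends M e u v -> joined M A u v.
Proof. by move=> Ae uv; exists [:: (e, v)]. Qed.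

Lemma walk_sub A B u p v : A `<=` B -> walk M A u p v -> walk M B u p v.
Proof.
by move=> AB; elim: p u => [//|[e w] p IH] u /= [/AB Be uw wv]; split=> //; exact: IH.
Qed.

Lemma joined_sub A B u v : A `<=` B -> joined M A u v -> joined M B u v.
Proof. by move=> AB [p up]; exists p; exact: walk_sub up. Qed.

Hypothesis ends_sym : forall e u v, mends M e u v -> mends M e v u.

Lemma joined_sym A u v : joined M A u v -> joined M A v u.
Proof.
move=> [p]; elim: p u => [|[e w] p IH] u /=; first by move=> ->; exact: joined_refl.
move=> [Ae uw wv]; apply: joined_trans (IH _ wv) _.
by apply: joined_edge Ae _; exact: ends_sym.
Qed.

Lemma simple_suffix A w q v u : walk M A w q v -> uniq (w :: unzip2 q) ->
  u \in w :: unzip2 q -> exists q', walk M A u q' v /\ uniq (u :: unzip2 q').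
Proof.
elim: q w => [|[e x] q IH] w.
  by rewrite /= mem_seq1 => -> _ /eqP ->; exists [::].
move=> wq wu; rewrite in_cons => /predU1P[->|]; first by exists ((e, x) :: q).
by case: wq => _ _ xv; case/andP: wu => _ xu; exact: IH.
Qed.

Lemma simple_walk A u v : joined M A u v ->
  exists p, walk M A u p v /\ uniq (u :: unzip2 p).
Proof.
move=> [p]; elim: p u => [|[e w] p IH] u /=; first by move=> ->; exists [::].
move=> [Ae uw /IH[q [wq wu]]]; case: (boolP (u \in w :: unzip2 q)) => uq.
  exact: simple_suffix wq wu uq.
by exists ((e, w) :: q); split; rewrite //= uq.
Qed.

Lemma walk_edge A u p v e : walk M A u p v -> e \in unzip1 p ->
  exists a b, [/\ A e, mends M e a b, a \in u :: unzip2 p & b \in unzip2 p].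
Proof.
elim: p u => [//|[e' w] p IH] u /= [Ae uw wv]; rewrite in_cons => /predU1P[->|ep].
  by exists u, w; split=> //; rewrite mem_head.
have [a [b [? ? ap bp]]] := IH _ wv ep.
by exists a, b; split=> //; rewrite in_cons ?ap ?bp orbT.
Qed.

Hypothesis ends_uniq : forall e a b c d,
  mends M e a b -> mends M e c d -> (a = c /\ b = d) \/ (a = d /\ b = c).

(** If the first edge were used again, its endpoint [u] would be visited again. *)
Lemma simple_walk_edges A u p v : walk M A u p v -> uniq (u :: unzip2 p) ->
  uniq (unzip1 p).
Proof.
elim: p u => [//|[e w] p IH] u [Ae uw wv] /= /andP[uNp wu].
rewrite (IH _ wv wu) andbT; apply/negP => ep.
have [a [b [_ ab ap bp]]] := walk_edge wv ep.
have /negP[] := uNp; case: (ends_uniq uw ab) => -[-> _] //.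
by rewrite in_cons bp orbT.
Qed.

Lemma cycle_of_chord A B e u v : B `<=` A -> A e -> ~ B e -> mends M e u v ->
  joined M B v u -> cycle_in M A.
Proof.
move=> BA Ae nBe uv /simple_walk[p [vp pu]].
exists u, ((e, v) :: p); split=> //=.
  by split=> //; exact: walk_sub vp.
rewrite (simple_walk_edges vp pu) andbT; apply/negP => ep.
by have [a [b []]] := walk_edge vp ep.
Qed.

(** [r] is the distance to [z] in [A], and the first edge of a shortest walk decreases it. On
    vertices not joined to [z] its value is arbitrary. *)
Lemma descending_rank A z : exists r : W -> nat, forall u, joined M A u z -> u <> z ->
  exists e w, [/\ A e, mends M e u w & (r w < r u)%N].
Proof.
pose D u n := exists2 p, walk M A u p z & size p = n.
have Dmin u : exists n, joined M A u z -> D u n /\ forall m, D u m -> (n <= m)%N.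
  have [[p up]|] := pselect (joined M A u z); last by exists 0%N.
  have exD : exists n, `[< D u n >] by exists (size p); apply/asboolP; exists p.
  exists (ex_minn exD) => _; case: ex_minnP => m /asboolP Dm mmin; split=> // k Dk.
  by apply: mmin; exact/asboolP.
have [r rP] := choice Dmin; exists r => u uz nuz.
have [[[|[e w] p] up sp] _] := rP u uz; first by case: nuz.
case: up => Ae uw wz; exists e, w; split=> //.
rewrite -sp /= ltnS; apply: (rP w _).2; last by exists p.
by exists p.
Qed.

End walks.

(** * Forests as wired spanning trees *)

Section spanning_trees.
Variables (V : choiceType) (G : sgraph V).
Hypothesis lfG : locally_finite G.

Lemma fset2_eq (a b c d : V) : [fset a; b]%fset = [fset c; d]%fset ->
  (a = c /\ b = d) \/ (a = d /\ b = c).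
Proof.
move=> E.
have /fset2P ha : a \in [fset c; d]%fset by rewrite -E fset21.
have /fset2P hb : b \in [fset c; d]%fset by rewrite -E fset22.
have /fset2P hc : c \in [fset a; b]%fset by rewrite E fset21.
have /fset2P hd : d \in [fset a; b]%fset by rewrite E fset22.
by move: ha hb hc hd => [] ? [] ? [] ? [] ?; subst; auto.
Qed.

Lemma edge_exists u v : adj G u v -> exists e : edge G, val e = [fset u; v]%fset.
Proof.
move=> uv; have ed : edges G [fset u; v]%fset by exists u, v.
by exists (SigSub (mem_set ed)).
Qed.

Lemma edge_adj (e : edge G) u v : val e = [fset u; v]%fset -> adj G u v.
Proof.
move=> euv; have [a [b [ab]]] := set_mem (valP e); rewrite euv.
by case/fset2_eq => -[-> ->] //; exact: adj_sym.
Qed.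

Lemma wired_ends_sym S (e : edge G) a b : wired_ends S e a b -> wired_ends S e b a.
Proof. by move=> [u [v [euv -> ->]]]; exists v, u; split=> //; rewrite fsetUC. Qed.

Lemma wired_ends_uniq S (e : edge G) a b c d :
  wired_ends S e a b -> wired_ends S e c d -> (a = c /\ b = d) \/ (a = d /\ b = c).
Proof.
move=> [u [v [euv -> ->]]] [u' [v' [+ -> ->]]]; rewrite euv => /fset2_eq.
by case=> -[-> ->]; [left | right].
Qed.

Definition neighbors (v : V) : {fset V} := fset_set [set u | adj G v u].

Lemma in_neighbors v u : (u \in neighbors v) = `[< adj G v u >].
Proof. by rewrite in_fset_set //; apply/idP/asboolP => [/set_mem|/mem_set]. Qed.

(** This finite set contains both ends of every edge kept in the wired graph. Its vertices outside
    [S], all identified to [None] there, are the fixed points of the forests. *)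
Definition closed_nbhd (S : {fset V}) : {fset V} :=
  (S `|` \bigcup_(v <- S) neighbors v)%fset.

Variable S : {fset V}.
Local Notation U := (closed_nbhd S).
Implicit Types (f : {ffun U -> U}) (v : U).

Definition interior_vertex : {pred U} := [pred v | val v \in S].
Definition adj_rel : rel U := [rel u v | `[< adj G (val u) (val v) >]].
Local Notation forest := (forest interior_vertex adj_rel).

Definition forest_tree f : config G :=
  fun e => [exists v, (v \in interior_vertex) && (val e == [fset val v; val (f v)]%fset)].

Lemma forest_treeP f e : reflect
  (exists2 v : U, val v \in S & val e = [fset val v; val (f v)]%fset) (forest_tree f e).
Proof.
apply: (iffP existsP) => [[v /andP[vS /eqP]]|[v vS ev]]; exists v => //.
by rewrite ev eqxx andbT.
Qed.

Lemma sub_nbhd (v : V) : v \in S -> v \in U.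
Proof. by move=> vS; rewrite in_fsetU vS. Qed.

Lemma adj_nbhd (v u : V) : v \in S -> adj G v u -> u \in U.
Proof.
move=> vS vu; rewrite in_fsetU; apply/orP; right; apply/bigfcupP; exists v.
  by rewrite vS.
by rewrite in_neighbors; apply/asboolP.
Qed.

Lemma forest_tree_step f v : f \in forest ->
  joined (wired G S) (edge_set (forest_tree f)) (contract S (val v)) (contract S (val (f v))).
Proof.
move=> /forestP[fe fS _]; have [vS|vS] := boolP (v \in interior_vertex).
  have /asboolP/edge_exists[e ev] := fe _ vS.
  apply: (@joined_edge _ _ _ _ e); first by apply/forest_treeP; exists v.
  by exists (val v), (val (f v)).
by rewrite fS //; exact: joined_refl.
Qed.

Lemma forest_tree_root f (v : V) : f \in forest ->
  joined (wired G S) (edge_set (forest_tree f)) (contract S v) None.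
Proof.
move=> ff; have [vS|/negbTE vS] := boolP (v \in S); last first.
  by rewrite /contract vS; exact: joined_refl.
have main n (w u : U) : u \notin interior_vertex -> iter n f w = u ->
    joined (wired G S) (edge_set (forest_tree f)) (contract S (val w)) None.
  move=> uS; elim: n w => [|n IH] w.
    by move=> /= ->; rewrite /contract (negbTE (uS : val u \notin S)); exact: joined_refl.
  by rewrite iterSr => /IH; apply: joined_trans; exact: forest_tree_step.
have [_ _ fr] := forestP _ _ _ ff; have vU := sub_nbhd vS.
have [u uS /reachP[n]] := fr (FSetSub vU) vS; exact: main.
Qed.

(* Each edge of a cycle would be the outgoing edge of one of its vertices; since
   there are as many edges as vertices, [f] would map the cycle to itself. *)
Lemma forest_tree_acyclic f : f \in forest ->
  ~ cycle_in (wired G S) (edge_set (forest_tree f)).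
Proof.
move=> ff [a [p [p0 ap u1 u2]]].
have aS : a \in unzip2 p.
  rewrite -(walk_last ap); case: p p0 {ap u1 u2} => [//|[e w] p] _.
  exact: (mem_last w (unzip2 p)).
(* The default [None] does not occur on the cycle, by [tailP]. *)
pose tail (e : edge G) := if [pick v | (v \in interior_vertex) &&
  (val e == [fset val v; val (f v)]%fset)] is Some v then contract S (val v) else None.
have tailP e : e \in unzip1 p -> exists v : U, [/\ val v \in S,
    val e = [fset val v; val (f v)]%fset, tail e = Some (val v),
    Some (val v) \in unzip2 p & contract S (val (f v)) \in unzip2 p].
  move=> ep; have [b [c [/forest_treeP[v vS ev] bc bp cp]]] := walk_edge ap ep.
  have bp' : b \in unzip2 p by move: bp; rewrite in_cons => /predU1P[->|].
  rewrite /tail; case: pickP => [v' /andP[v'S /eqP ev']|/(_ v)]; last first.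
    by rewrite ev eqxx andbT inE vS.
  have cv : contract S (val v') = Some (val v') by rewrite /contract (v'S : val v' \in S).
  have vv : wired_ends S e (contract S (val v')) (contract S (val (f v'))).
    by exists (val v'), (val (f v')).
  by exists v'; rewrite -cv; case: (wired_ends_uniq vv bc) => -[-> ->].
have tinj : {in unzip1 p &, injective tail}.
  move=> e e' /tailP[v [_ ev -> _ _]] /tailP[v' [_ ev' -> _ _]] [/val_inj vv'].
  by apply: val_inj; rewrite ev ev' vv'.
have [] := @uniq_min_size _ (map tail (unzip1 p)) (unzip2 p).
- by rewrite map_inj_in_uniq.
- by move=> _ /mapP[e /tailP[v [_ _ -> vp _]] ->].
- by rewrite !size_map.
move=> _ tailE.
have closed v : Some (val v) \in unzip2 p -> Some (val (f v)) \in unzip2 p.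
  rewrite -tailE => /mapP[e ep tv]; have [w [_ _ tw _ fw]] := tailP _ ep.
  have {tv tw} -> : v = w by apply: val_inj; move: tw; rewrite -tv => -[].
  move: (fw); rewrite /contract; case: ifP => //= _; rewrite -tailE.
  by move=> /mapP[e' /tailP[? [_ _ -> _ _]]].
(* Being closed under [f], the cycle would contain a vertex outside [S], but all its vertices are
   tails and lie in [S]. *)
rewrite -tailE in aS; case/mapP: aS => e /tailP[v [vS _ _ vp _]] _.
have [_ _ fr] := forestP _ _ _ ff; have [u uS /reachP[n nu]] := fr v vS.
have : Some (val u) \in unzip2 p by rewrite -nu; elim: n {nu} => //= n; exact: closed.
rewrite -tailE => /mapP[e' /tailP[w [wS _ -> _ _]] [/val_inj uw]].
by rewrite uw inE wS in uS.
Qed.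

Lemma forest_tree_spanning f : f \in forest -> @spanning_trees V G S (forest_tree f).
Proof.
move=> ff; split; last exact: forest_tree_acyclic.
- move=> e /forest_treeP[v vS ev] [a [u [w [euw au aw]]]].
  have uw : contract S u = contract S w by rewrite -au.
  have fvv : val (f v) = val v.
    have [[uv wv]|[uv wv]] := fset2_eq (etrans (esym ev) euw).
      by move: uw; rewrite -uv -wv /contract vS; case: ifP => // _ [].
    by move: uw; rewrite -uv -wv /contract vS; case: ifP => // _ [].
  by move: (edge_adj ev); rewrite fvv => vv; case: (adj_irr vv).
- move=> a b [u _ ua] [v _ vb]; rewrite -ua -vb; apply: joined_trans (forest_tree_root u ff) _.
  by apply: joined_sym; [exact: wired_ends_sym | exact: forest_tree_root].
Qed.

(** Induction on the number of steps to the boundary. The edge from [u] to [f u] is outgoing for [g]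
    at [u], as desired, or at [f u]; in the latter case [f] and [g] agree at [f u], so [f] has a
    2-cycle. *)
Lemma forest_tree_inj : {in forest &, injective forest_tree}.
Proof.
move=> f g ff fg fgE; apply/ffunP => v.
have [fe fS fr] := forestP _ _ _ ff; have [ge gS gr] := forestP _ _ _ fg.
have main n : forall v, iter n f v \notin interior_vertex -> f v = g v.
  elim: n => [|n IH] u; first by move=> uS; rewrite fS // gS.
  have [uS|uS] := boolP (u \in interior_vertex); last by rewrite fS // gS.
  rewrite iterSr => /IH ffu; have /asboolP/edge_exists[e eu] := fe _ uS.
  have : forest_tree g e by rewrite -fgE; apply/forest_treeP; exists u.
  move=> /forest_treeP[w wS]; rewrite eu => /fset2_eq[] [/val_inj uw /val_inj fuw].
    by rewrite fuw uw.
  have /negP[] := forest_acyclic ff uS; apply/reachP; exists 1%N.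
  by rewrite /= ffu fuw uw.
have [vS|vS] := boolP (v \in interior_vertex); last by rewrite fS // gS.
have [u uS /reachP[n nu]] := fr v vS.
by apply: (main n); rewrite nu.
Qed.

(* Moving from each vertex to one that is closer to the root in [w] defines a
   forest; any other edge of [w] would close a cycle. *)
Lemma forest_tree_surj : infinite_set [set: V] -> forall w, @spanning_trees V G S w ->
  exists2 f, f \in forest & forest_tree f = w.
Proof.
move=> infV w [wE wJ wC].
(* A vertex outside [S] makes [None] a vertex of the wired graph. *)
have [z zS] : exists z, z \notin S.
  apply: contrapT => nz; apply: infV; apply: sub_finite_set (finite_fset S) => z _.
  by apply: contrapT => zS; apply: nz; exists z; exact/negP.
have toNone (v : V) : joined (wired G S) (edge_set w) (contract S v) None.
  apply: wJ; first by exists v.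
  by exists z => //; rewrite /contract (negbTE zS).
have [r rP] := @descending_rank _ _ (wired G S) (edge_set w) None.
have next (u : U) : exists u' : U, if val u \in S then exists e : edge G, [/\ w e,
    val e = [fset val u; val u']%fset & (r (contract S (val u')) < r (Some (val u)))%N]
    else u' = u.
  case: (boolP (val u \in S)) => uS; last by exists u.
  have cu : contract S (val u) = Some (val u) by rewrite /contract uS.
  have := rP (Some (val u)); rewrite -cu => /(_ (toNone _)).
  rewrite {1}cu => /(_ _)[//|e [c [we [a [b [eab ua ->]]] rc]]].
  have au : a = val u by move: ua; rewrite cu /contract; case: ifP => // _ [].
  rewrite {}au {ua} in eab; have bU := adj_nbhd uS (edge_adj eab).
  by exists [` bU]%fset, e.
have [g gP] := choice next; pose f : {ffun U -> U} := [ffun u => g u].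
have gS v : v \in interior_vertex -> exists e : edge G, [/\ w e,
    val e = [fset val v; val (g v)]%fset & (r (contract S (val (g v))) < r (Some (val v)))%N].
  by move=> vS; move: (gP v); rewrite (vS : val v \in S).
have ff : f \in forest.
  apply/forestP; split=> [v vS|v vS|v vS].
  - rewrite ffunE; apply/asboolP; have [e [_ ev _]] := gS v vS.
    exact: edge_adj ev.
  - by rewrite ffunE; move: (gP v); rewrite (negbTE (vS : val v \notin S)).
  - have [n] := ubnP (r (Some (val v))); elim: n v vS => // n IH v vS.
    rewrite ltnS => rn; have [e [_ _ rg]] := gS v vS.
    have vf : fconnect f v (g v) by apply: connect1; rewrite /= ffunE.
    have [gvS|gvS] := boolP (g v \in interior_vertex); last by exists (g v).
    have [|u uS gu] := IH (g v) gvS; last by exists u => //; exact: connect_trans gu.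
    by apply: leq_trans rn; move: rg; rewrite /contract (gvS : val (g v) \in S).
exists f => //; apply/funext => e.
have sub e' : forest_tree f e' -> w e'.
  move=> /forest_treeP[v vS ev]; have [e'' [we'' ev'' _]] := gS v vS.
  suff -> : e' = e'' by [].
  by apply: val_inj; rewrite ev ev'' ffunE.
apply/idP/idP; first exact: sub.
apply: contraTT => nfe; apply/negP => we; apply: wC.
have [a [b [ab eab]]] := set_mem (valP e).
apply: (@cycle_of_chord _ _ (wired G S) (@wired_ends_uniq S) _
  (edge_set (forest_tree f)) e (contract S a) (contract S b)) => //; first exact/negP.
  by exists a, b.
apply: joined_trans (forest_tree_root _ ff) _.
by apply: joined_sym; [exact: wired_ends_sym | exact: forest_tree_root].
Qed.

Lemma ust_meanE (R : realType) (F : config G -> R) : infinite_set [set: V] ->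
  ust_mean S F = ((\sum_(f in forest) F (forest_tree f)) / #|forest|%:R)%R.
Proof.
move=> infV.
have E : @spanning_trees V G S = [set` [fset forest_tree f | f in enum forest]%fset].
  apply/seteqP; split=> [w /(forest_tree_surj infV)[f ff <-]|w].
    by apply/imfsetP; exists f; rewrite //= mem_enum.
  by move=> /imfsetP[f /=]; rewrite mem_enum => ff ->; exact: forest_tree_spanning.
have P : perm_eq (fset_set (@spanning_trees V G S)) (map forest_tree (enum forest)).
  apply: uniq_perm; rewrite ?fset_uniq ?map_inj_in_uniq ?enum_uniq //.
    by move=> f g; rewrite !mem_enum; exact: forest_tree_inj.
  move=> w; rewrite E set_fsetK; apply/imfsetP/mapP => -[f /= ff ->]; by exists f.
rewrite /ust_mean (perm_big _ P) /= big_map big_enum /=.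
by rewrite (perm_size P) size_map -cardE.
Qed.

End spanning_trees.

(** * The permutation topology *)

Section prod_discrete.
Variables (I : choiceType) (K : I -> discreteTopologicalType).

(** The product topology is a supremum of initial topologies, so the filters may be compared one
    coordinate at a time. *)
Lemma nbhs_prod_discrete (f : prod_topology K) (W : set (prod_topology K)) :
  nbhs f W <-> exists s : seq I, [set g | forall i, i \in s -> g i = f i] `<=` W.
Proof.
split.
  pose F : set_system (prod_topology K) :=
    [set W | exists s : seq I, [set g | forall i, i \in s -> g i = f i] `<=` W].
  have FF : Filter F.
    split.
    - by exists [::].
    - move=> P Q [s sP] [t tQ]; exists (s ++ t) => g gst; split.
        by apply: sP => i si; apply: gst; rewrite mem_cat si.
      by apply: tQ => i si; apply: gst; rewrite mem_cat si orbT.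
    - by move=> P Q PQ [s sP]; exists s; apply: subset_trans PQ.
  move: W; apply/(@cvg_sup _ _ _ F f) => i W.
  rewrite nbhsE => -[B [[C oC <-] Cf] BW].
  exists [:: i] => g gi; apply: BW; rewrite /preimage /=.
  by rewrite gi ?mem_head.
case=> s; elim: s W => [|i s IH] W sW.
  by apply: filterS filterT => g _; exact: sW.
have : nbhs f ([set g : prod_topology K | g i = f i] `&`
  [set g | forall j, j \in s -> g j = f j]).
  apply: filterI; last exact: IH.
  have := @proj_continuous I K i f [set f i].
  by rewrite nbhs_principalE; apply.
apply: filterS => g [gi gs]; apply: sW => j; rewrite in_cons.
by move=> /predU1P[->|/gs].
Qed.
End prod_discrete.

(** This lets an ultrafilter on a stabilizer choose one image of each vertex among finitely many. *)
Lemma ultra_seq_bigcup (T : Type) (I : eqType) (F : set_system T) (B : I -> set T)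
    (s : seq I) :
  UltraFilter F -> F [set t | exists2 i, i \in s & B i t] -> exists i, F (B i).
Proof.
move=> FU; elim: s => [|i s IH] FB; first by have [t [j]] := filter_ex FB.
have [Fi|FNi] := in_ultra_setVsetC (B i) FU; first by exists i.
apply: IH; apply: filterS (filterI FB FNi) => t [[j]].
by rewrite in_cons => /predU1P[-> //|js Bj _]; exists j.
Qed.

(** * Topology of the action on vertices *)

Section vertex_action.
Variables (V : choiceType) (G : sgraph V).

Lemma nbhs_aut (g : aut G) (W : set (aut G)) :
  nbhs g W <-> exists s : seq V,
    [set h | forall v, v \in s -> aut_fun h v = aut_fun g v] `<=` W.
Proof.
split.
  case=> _ /= [] [C oC <-] /= Cg sCW.
  have [s sC] := (@nbhs_prod_discrete V (fun=> discrete_topology V) (val g) C).1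
    (open_nbhs_nbhs (conj oC Cg)).
  by exists s => h hs; apply: sCW; exact: sC.
case=> s sW; apply: filterS sW _.
apply: (@initial_continuous (aut G) _ val g
  [set h : {ptws V -> discrete_topology V} | forall v, v \in s -> h v = val g v]).
by apply/(@nbhs_prod_discrete V (fun=> discrete_topology V)); exists s.
Qed.

Variable Gamma : closed_subgroup G.
Local Notation T := (csg Gamma).
Local Notation stab := (@stabilizer V G Gamma).
Implicit Types (g h : T) (v u x y : V).

Lemma nbhs_csg g (W : set T) : nbhs g W <-> exists s : seq V,
    [set h | forall v, v \in s -> act h v = act g v] `<=` W.
Proof.
split.
  case=> _ /= [] [C oC <-] /= Cg sCW.
  have [s sC] := (nbhs_aut (val g) C).1 (open_nbhs_nbhs (conj oC Cg)).
  by exists s => h hs; apply: sCW; exact: sC.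
case=> s sW; apply: filterS sW _.
apply: (@initial_continuous T _ val g
  [set h : aut G | forall v, v \in s -> aut_fun h v = aut_fun (val g) v]).
by apply/nbhs_aut; exists s.
Qed.

Lemma actM g h v : act (g * h)%g v = act g (act h v).
Proof. by []. Qed.

Lemma actK g : cancel (act g) (act g^-1%g).
Proof. by move=> v; rewrite -actM mulVg. Qed.

Lemma actVK g : cancel (act g^-1%g) (act g).
Proof. by move=> v; rewrite -actM mulgV. Qed.

Lemma act_adj g u v : adj G (act g u) (act g v) <-> adj G u v.
Proof. by have [_] := set_mem (valP (val g)); apply. Qed.

(** [Gamma] is closed, and the hypothesis places [f] in its closure. *)
Lemma csg_lift (f : aut G) :
  (forall s : seq V, exists g : T, forall v, v \in s -> act g v = aut_fun f v) ->
  exists g : T, val g = f.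
Proof.
move=> fs; have fG : csg_set Gamma f.
  apply: (@csg_closed _ _ Gamma) => W /nbhs_aut[s sW]; have [g gs] := fs s.
  by exists (val g); split; [exact: set_mem (valP g) | exact: sW].
by exists (SigSub (mem_set fG)).
Qed.

(** Basic open sets; a nonempty one is a left coset of a pointwise stabilizer. *)
Definition cylinder (l : seq (V * V)) : set T :=
  [set g | forall p, p \in l -> act g p.1 = p.2].

Lemma open_cylinder l : open (cylinder l).
Proof.
rewrite openE => g gl; apply/nbhs_csg; exists (unzip1 l) => h hl p pl.
by rewrite hl ?gl //; apply: map_f.
Qed.

Lemma stabilizer_cylinder x : stab x = cylinder [:: (x, x)].
Proof.
apply/seteqP; split=> [g gx p|g gx]; last by apply: (gx (x, x)); rewrite mem_head.
by rewrite mem_seq1 => /eqP ->.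
Qed.

Hypotheses (lfG : locally_finite G) (connG : connected_graph G).

(** Finiteness propagates along a walk from [x], as neighbours are sent to neighbours and the graph
    is locally finite. *)
Lemma stabilizer_orbit_finite x v :
  exists s : seq V, forall g, stab x g -> act g v \in s.
Proof.
have [p] := connG x v.
suff main u : (exists s : seq V, forall g, stab x g -> act g u \in s) ->
    walk (to_multigraph G) setT u p v ->
    exists s : seq V, forall g, stab x g -> act g v \in s.
  by apply: main; exists [:: x] => g ->; rewrite mem_head.
elim: p u => [|[e w] p IH] u us /=; first by move=> <-.
move=> [_ euw]; apply: IH; have [s us'] := us.
exists (flatten [seq enum_fset (neighbors G a) | a <- s]) => g gx.
apply/flatten_mapP; exists (act g u); first exact: us'.
by rewrite in_neighbors //; apply/asboolP/act_adj; exact: edge_adj euw.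
Qed.

(** An ultrafilter on the stabilizer fixes one image [f v] of each vertex [v], and [f] is its
    limit. *)
Lemma stabilizer_compact x : compact (stab x).
Proof.
rewrite compact_ultra => F FU Fx.
have Fpick v : exists u, F [set g | act g v = u].
  have [s sP] := stabilizer_orbit_finite x v.
  apply: (@ultra_seq_bigcup _ _ F (fun u => [set g | act g v = u]) s).
  by apply: filterS Fx => g /sP gs; exists (act g v).
(* The limit of the inverses supplies an inverse of [f]; a pointwise limit of bijections need not be
   onto. *)
have Fpick' v : exists u, F [set g | act g^-1%g v = u].
  have [s sP] := stabilizer_orbit_finite x v.
  apply: (@ultra_seq_bigcup _ _ F (fun u => [set g | act g^-1%g v = u]) s).
  apply: filterS Fx => g gx; exists (act g^-1%g v) => //.
  by apply: sP; rewrite /stabilizer /= -{1}(gx : act g x = x) actK.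
have [f fP] := choice Fpick; have [f' fP'] := choice Fpick'.
have Fseq (s : seq V) : F [set g | forall v, v \in s -> act g v = f v].
  elim: s => [|v s IH]; first by apply: filterS filterT.
  by apply: filterS (filterI (fP v) IH) => g [gv gs] u; rewrite in_cons => /predU1P[->|/gs].
have fK : cancel f f'.
  move=> v; have [g [/= gv gv']] := filter_ex (filterI (fP v) (fP' (f v))).
  by rewrite -gv' -gv actK.
have fK' : cancel f' f.
  move=> v; have [g [/= gv gv']] := filter_ex (filterI (fP' v) (fP (f' v))).
  by rewrite -gv' -gv actVK.
have fA : automorphisms G f.
  split; first by exists f'.
  move=> u v; have [g [/= <- <-]] := filter_ex (filterI (fP u) (fP v)).
  exact: act_adj.
have [g gf] : exists g : T, val g = SigSub (mem_set fA).
  apply: csg_lift => s; have [g gs] := filter_ex (Fseq s).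
  by exists g => v /gs.
have gE v : act g v = f v by rewrite /act gf.
exists g; split.
  have [h [/= hx hx']] := filter_ex (filterI (fP x) Fx).
  by rewrite /stabilizer /= gE -hx.
move=> W /nbhs_csg[s sW]; apply: filterS (Fseq s) => h hs; apply: sW => v /hs ->.
by rewrite gE.
Qed.

End vertex_action.

(** * Haar measure of stabilizers *)

Section haar_of_stabilizers.
Variables (R : realType) (V : choiceType) (G : sgraph V) (Gamma : closed_subgroup G).
Local Notation T := (csg Gamma).
Local Notation stab := (@stabilizer V G Gamma).
Local Notation cylinder := (@cylinder V G Gamma).
Local Notation measureT := {measure set (borel T) -> \bar R}.
Implicit Types (m : measureT) (g h : T) (u v x y : V) (s : seq V) (l : seq (V * V)).

(** The pointwise stabilizer of [s]. *)
Definition pstab s := cylinder [seq (v, v) | v <- s].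

Lemma pstabP s g : pstab s g <-> forall v, v \in s -> act g v = v.
Proof.
split=> [gs v vs|gs p /mapP[v vs ->]]; last exact: gs.
by apply: (gs (v, v)); apply: map_f.
Qed.

Lemma pstab1 x : pstab [:: x] = stab x.
Proof. by rewrite stabilizer_cylinder. Qed.

Lemma measurable_cylinder l : measurable (cylinder l : set (borel T)).
Proof. by apply: sub_sigma_algebra; exact: open_cylinder. Qed.

Lemma cylinder_coset l g : cylinder l g ->
  cylinder l = [set (g * h)%g | h in pstab (unzip1 l)].
Proof.
move=> gl; apply/seteqP; split=> [k kl|_ [h /pstabP hl <-] p pl].
  exists (g^-1 * k)%g; last by rewrite mulgA mulgV mul1g.
  apply/pstabP => v /mapP[p pl ->]; rewrite actM kl // -(gl p pl); exact: actK.
by rewrite actM hl ?gl //; apply: map_f.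
Qed.

Lemma left_invariant_cylinder m l g : left_invariant m -> cylinder l g ->
  m (cylinder l) = m (pstab (unzip1 l)).
Proof.
by move=> mL /cylinder_coset ->; rewrite mL //; exact: measurable_cylinder.
Qed.

Lemma sume_const_seq (I : Type) (r : seq I) (c : \bar R) : (0 <= c)%E ->
  (\sum_(i <- r) c = (size r)%:R%:E * c)%E.
Proof.
move=> c0; elim: r => [|i r IH]; first by rewrite big_nil mul0e.
by rewrite big_cons IH /= -natr1 addrC EFinD ge0_muleDl ?lee_fin // mul1e.
Qed.

Hypotheses (lfG : locally_finite G) (connG : connected_graph G).

(* [k] is the size of the orbit of [v] under [pstab s], whatever the measure. *)
Lemma pstab_index s v x : x \in s -> exists2 k : nat, (0 < k)%N &
  forall m, left_invariant m -> m (pstab s) = (k%:R%:E * m (pstab (v :: s)))%E.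
Proof.
move=> xs; pose O := [set act g v | g in pstab s].
have Ofin : finite_set O.
  have [r rP] := stabilizer_orbit_finite Gamma lfG connG x v.
  apply: (@sub_finite_set _ _ [set` r]); last exact: finite_seq.
  by move=> _ [g /pstabP gs <-]; apply: rP; exact: gs.
pose F u := cylinder ((v, u) :: [seq (w, w) | w <- s]).
(* Splitting by the image of [v] gives one left coset of [pstab (v :: s)] for each point of the
   orbit. *)
have sE : pstab s = \bigcup_(u in O) F u.
  apply/seteqP; split=> [g gs|g [u _ gF] p ps]; last first.
    by apply: gF; rewrite in_cons ps orbT.
  exists (act g v); first by exists g.
  by move=> p; rewrite in_cons => /predU1P[->//|/gs].
exists #|` fset_set O|.
  rewrite cardfs_gt0; apply/fset0Pn; exists v; rewrite in_fset_set //; apply/mem_set.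
  by exists 1%g => //; apply/pstabP.
move=> m mL; rewrite sE measure_fin_bigcup //.
- rewrite fsbig_finite //= -sume_const_seq // big_seq [RHS]big_seq.
  apply: eq_bigr => u; rewrite in_fset_set // => /set_mem[g gs gv].
  rewrite (left_invariant_cylinder (g := g)) //; last first.
    by move=> p; rewrite in_cons => /predU1P[->//|/gs].
  by congr (m (pstab (_ :: _))); elim: (s) => //= a r ->.
- move=> u u' _ _ [g [gu gu']].
  have := gu (v, u) (mem_head _ _); have := gu' (v, u') (mem_head _ _).
  by move=> /= <- <-.
- by move=> u _; exact: measurable_cylinder.
Qed.

Lemma eq_pstab s s' : s =i s' -> pstab s = pstab s'.
Proof.
by move=> ss; apply/seteqP; split=> g /pstabP gs; apply/pstabP => v vs;
  apply: gs; rewrite ?ss // -ss.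
Qed.

(** The indices are multiplied while the vertices of [s] are added one at a time; [x], appended at
    the end, starts the induction. *)
Lemma stab_index x s : x \in s -> exists2 k : nat, (0 < k)%N &
  forall m, left_invariant m -> m (stab x) = (k%:R%:E * m (pstab s))%E.
Proof.
move=> xs; rewrite (@eq_pstab s (s ++ [:: x])); last first.
  by move=> v; rewrite mem_cat mem_seq1; case: eqP => [->|_]; rewrite ?xs ?orbT ?orbF.
elim: s {xs} => [|v s [k k0 kP]].
  by exists 1%N => // m _; rewrite mul1e pstab1.
have xsx : x \in s ++ [:: x] by rewrite mem_cat mem_head orbT.
have [j j0 jP] := pstab_index v xsx.
by exists (k * j)%N => [|m mL]; rewrite ?muln_gt0 ?k0 // kP // jP // muleA -EFinM natrM.
Qed.

(** Both stabilizers contain [pstab [:: x; y]] with finite indices that do not depend on the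
    measure. *)
Lemma haar_ratio m1 m2 x y : left_invariant m1 -> left_invariant m2 ->
  (m1 (stab x) * m2 (stab y) = m1 (stab y) * m2 (stab x))%E.
Proof.
move=> L1 L2.
have [k _ kP] := @stab_index x [:: x; y] (mem_head _ _).
have [|j _ jP] := @stab_index y [:: x; y]; first by rewrite !inE eqxx orbT.
rewrite (kP m1) // (kP m2) // (jP m1) // (jP m2) //.
by rewrite muleACA [RHS]muleACA [(j%:R%:E * _)%E]muleC.
Qed.

Variables (e : nat -> V) (e_surj : forall v, exists n, e n = v).

(** Cylinders constraining [x] generate the Borel sets and are closed under intersection. A nonempty
    one is a coset of a subgroup of finite index in [stab x], so its measure is determined. *)
Lemma left_invariant_unique m1 m2 x : left_invariant m1 -> left_invariant m2 ->
  m1 (stab x) = m2 (stab x) -> (m1 (stab x) < +oo)%E ->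
  forall A, measurable A -> m1 A = m2 A.
Proof.
move=> L1 L2 E12 fin; pose C : set (set (borel T)) :=
  [set cylinder l | l in [set l | x \in unzip1 l]].
apply: (@measure_unique _ _ _ C (fun n => cylinder [:: (x, e n)])).
- apply/seteqP; split.
    apply: smallest_sub; first exact: smallest_sigma_algebra.
    move=> U oU.
    (* As [V] is countable, cylinders are enumerated through codes of lists. A code that decodes to
       nothing gives [[::]], which the test on [x] discards. *)
    pose l n : seq (V * V) := [seq (e p.1, e p.2) |
      p <- odflt [::] (choice.unpickle n : option (seq (nat * nat)))].
    have -> : U = \bigcup_n (if `[< x \in unzip1 (l n) /\ cylinder (l n) `<=` U >]
                             then cylinder (l n) else set0).
      apply/seteqP; split=> [g Ug|g [n _]]; last by case: asboolP => // -[_]; apply.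
      have [s sU] := (nbhs_csg g U).1 (open_nbhs_nbhs (conj oU Ug)).
      have [f fP] := choice e_surj.
      exists (choice.pickle [seq (f v, f (act g v)) | v <- x :: s]) => //.
      have -> : l (choice.pickle [seq (f v, f (act g v)) | v <- x :: s]) =
          [seq (v, act g v) | v <- x :: s].
        by rewrite /l choice.pickleK -map_comp; apply: eq_map => v; rewrite /= !fP.
      case: asboolP => [_|[]].
        by move=> p /mapP[v _ ->].
      split; first by rewrite /= mem_head.
      move=> h hs; apply: sU => v vs; apply: (hs (v, act g v)).
      by apply: map_f; rewrite in_cons vs orbT.
    apply: sigma_algebra_bigcup => n; case: asboolP => [[xl _]|_].
      by apply: sub_sigma_algebra; exists (l n).
    exact: sigma_algebra0.
  apply: smallest_sub; first exact: smallest_sigma_algebra.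
  by move=> _ [l _ <-]; exact: measurable_cylinder.
- move=> _ _ [l xl <-] [l' xl' <-]; exists (l ++ l').
    by rewrite /= /unzip1 map_cat mem_cat xl.
  apply/seteqP; split=> [g gl|g [gl gl'] p].
    by split=> p pl; apply: gl; rewrite mem_cat pl ?orbT.
  by rewrite mem_cat => /orP[/gl|/gl'].
- by move=> n; exists [:: (x, e n)] => //=; rewrite mem_head.
- apply/seteqP; split=> // g _; have [n ng] := e_surj (act g x).
  by exists n => // p; rewrite mem_seq1 => /eqP ->.
- move=> _ [l xl <-]; have [[g gl]|nl] := pselect (cylinder l !=set0); last first.
    have -> : cylinder l = set0 by apply/seteqP; split=> // g gl; case: nl; exists g.
    by rewrite !measure0.
  rewrite !(left_invariant_cylinder _ gl) //.
  have [k k0 kP] := stab_index xl; move: E12; rewrite kP // kP // => E12.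
  have cancel (a : \bar R) : (k%:R^-1%:E * (k%:R%:E * a) = a)%E.
    by rewrite muleA -EFinM mulVf ?mul1e // pnatr_eq0 -lt0n.
  by rewrite -[LHS]cancel E12 cancel.
- move=> n; apply: le_lt_trans fin.
  have [[g gl]|nl] := pselect (cylinder [:: (x, e n)] !=set0).
    by rewrite (left_invariant_cylinder _ gl) //= pstab1.
  have -> : cylinder [:: (x, e n)] = set0 by apply/seteqP; split=> // g gl; case: nl; exists g.
  by rewrite measure0.
Qed.

End haar_of_stabilizers.

(** * Right translates and harmonicity of the Haar weight *)

Section modular_function.
Variables (R : realType) (V : choiceType) (G : sgraph V) (Gamma : closed_subgroup G).
Local Notation T := (csg Gamma).
Local Notation stab := (@stabilizer V G Gamma).
Local Notation cylinder := (@cylinder V G Gamma).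
Local Notation measureT := {measure set (borel T) -> \bar R}.
Implicit Types (m : measureT) (g h : T) (u v x y : V).
Hypotheses (lfG : locally_finite G) (connG : connected_graph G).
Variables (e : nat -> V) (e_surj : forall v, exists n, e n = v).

Definition rmul g : borel T -> borel T := fun h : T => (h * g)%g.

Lemma measurable_rmul g : measurable_fun [set: borel T] (rmul g).
Proof.
apply: (@measurability _ _ (borel T) (borel T) setT (rmul g) (@open T)) => //.
move=> _ [U oU <-]; rewrite setTI.
apply: sub_sigma_algebra; rewrite openE => h /= Uh; apply/nbhs_csg.
have [s sU] := (nbhs_csg (h * g)%g U).1 (open_nbhs_nbhs (conj oU Uh)).
exists (map (act g) s) => k ks; apply: sU => v vs.
by rewrite !actM ks //; exact: map_f.
Qed.

Definition rtranslate m g : measureT :=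
  measure_function_pushforward__canonical__measure_function_Measure m
    (measurable_rmul (g^-1)%g).

Lemma rtranslateE m g A : rtranslate m g A = m [set (h * g)%g | h in A].
Proof.
rewrite /rtranslate /= /pushforward; congr (m _).
apply/seteqP; split=> [h /= Ah|_ [h Ah <-]].
  by exists (h * g^-1)%g => //; rewrite -mulgA mulVg mulg1.
by rewrite /preimage /rmul /= -mulgA mulgV mulg1.
Qed.

Lemma rtranslate_left_invariant m g : left_invariant m -> left_invariant (rtranslate m g).
Proof.
move=> mL k A mA; rewrite !rtranslateE.
have -> : [set (h * g)%g | h in [set (k * h)%g | h in A]] =
          [set (k * h)%g | h in [set (h * g)%g | h in A]].
  apply/seteqP; split=> _ [_ [h Ah <-] <-].
    by exists (h * g)%g; [exists h | rewrite mulgA].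
  by exists (k * h)%g; [exists h | rewrite mulgA].
apply: mL; have -> : [set (h * g)%g | h in A] = rmul (g^-1)%g @^-1` A.
  apply/seteqP; split=> [_ [h Ah <-]|h /= Ah].
    by rewrite /preimage /rmul /= -mulgA mulgV mulg1.
  by exists (h * g^-1)%g => //; rewrite -mulgA mulVg mulg1.
by rewrite -[X in measurable X]setTI; exact: measurable_rmul.
Qed.

(** The right translate of [stab x] by [g] consists of the elements sending [g^-1 x] to [x], and is
    thus a left coset of the stabilizer of [g^-1 x]. *)
Lemma rtranslate_stab m g x : left_invariant m ->
  rtranslate m g (stab x) = m (stab (act g^-1%g x)).
Proof.
move=> mL; rewrite rtranslateE.
have -> : [set (h * g)%g | h in stab x] = cylinder [:: (act g^-1%g x, x)].
  apply/seteqP; split=> [_ [h hx <-] p|h hx].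
    by rewrite mem_seq1 => /eqP -> /=; rewrite actM actVK.
  exists (h * g^-1)%g; last by rewrite -mulgA mulVg mulg1.
  by rewrite /stabilizer /= actM; apply: (hx (act g^-1%g x, x)); rewrite mem_head.
rewrite (left_invariant_cylinder (g := g)) ?pstab1 //.
by move=> p; rewrite mem_seq1 => /eqP -> /=; rewrite actVK.
Qed.

Lemma haar_stab_lty m x : left_haar m -> (m (stab x) < +oo)%E.
Proof. by move=> [[mK _ _] _ _]; apply: mK; exact: stabilizer_compact. Qed.

(** The group is a countable union of left cosets of stabilizers having the measure of [stab x]. *)
Lemma haar_stab_gt0 m x : left_haar m -> (0 < m (stab x))%E.
Proof.
move=> [_ mL mT]; rewrite lt0e measure_ge0 andbT; apply/eqP => mx; case/eqP: mT.
have -> : [set: T] = \bigcup_n cylinder [:: (x, e n)].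
  apply/seteqP; split=> // g _; have [n ng] := e_surj (act g x).
  by exists n => // p; rewrite mem_seq1 => /eqP ->.
apply/eqP; rewrite -measure_le0.
apply: le_trans (measure_sigma_subadditive _ _ _ (@subset_refl _ _)) _.
- by move=> n; exact: measurable_cylinder.
- by apply: bigcupT_measurable => n; exact: measurable_cylinder.
rewrite eseries0 // => n _ _.
have [[g gl]|nl] := pselect (cylinder [:: (x, e n)] !=set0).
  by rewrite (left_invariant_cylinder mL gl) /= pstab1.
have -> : cylinder [:: (x, e n)] = set0 by apply/seteqP; split=> // g gl; case: nl; exists g.
by rewrite measure0.
Qed.

(** By [haar_ratio] every left Haar measure is also constant on stabilizers, so its right translates
    agree with it on [stab x] and uniqueness applies. *)
Lemma unimodular_of_const m : left_haar m -> (forall x y, m (stab x) = m (stab y)) ->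
  unimodular R T.
Proof.
move=> mH mc nu nH g A mA; rewrite -rtranslateE.
have [[_ mL _] [_ nL _]] := (mH, nH); pose x := e 0%N.
apply: (left_invariant_unique lfG connG e_surj (x := x)) => //.
- exact: rtranslate_left_invariant.
- rewrite rtranslate_stab //; set y := act _ x.
  have := haar_ratio lfG connG x y mL nL; rewrite (mc y x).
  have := haar_stab_gt0 x mH; have := haar_stab_lty x mH.
  case: (m (stab x)) => // r _ r0 E.
  have cancel (a : \bar R) : (r^-1%:E * (r%:E * a) = a)%E.
    by rewrite muleA -EFinM mulVf ?mul1e // gt_eqF.
  by rewrite -[LHS]cancel E cancel.
- by rewrite rtranslate_stab //; exact: haar_stab_lty.
Qed.

Variables (mu : measureT) (muH : left_haar mu).
Definition haar_weight x : R := fine (mu (stab x)).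
Local Notation m := haar_weight.

Lemma haar_weightE x : mu (stab x) = (m x)%:E.
Proof. by rewrite fineK // ge0_fin_numE ?haar_stab_lty ?measure_ge0. Qed.

Lemma haar_weight_gt0 x : 0 < m x.
Proof. by rewrite -lte_fin -haar_weightE haar_stab_gt0. Qed.

(** Compare [mu] with its right translate by [g^-1]. It follows that [Delta] is invariant under the
    diagonal action. *)
Lemma haar_weight_act g x y : m x * m (act g y) = m y * m (act g x).
Proof.
have [_ mL _] := muH.
have := haar_ratio lfG connG x y mL (rtranslate_left_invariant (g^-1)%g mL).
by rewrite !rtranslate_stab // !invgK !haar_weightE -!EFinM => -[].
Qed.

Hypothesis trans : transitive_on_vertices Gamma.

(* Both sides are the measure of [{g | g x ~ x}], split according to the image
   of [x] on the right and to its preimage on the left. *)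
Lemma haar_weight_harmonic x :
  \sum_(y <- neighbors G x) m y = #|` neighbors G x|%:R * m x.
Proof.
have [_ mL _] := muH; pose N := [set g : T | adj G x (act g x)].
have nbE y : [set` neighbors G x] y <-> adj G x y.
  by rewrite /= in_neighbors //; split=> /asboolP.
have disj (F : V -> set T) : (forall u v g, F u g -> F v g -> u = v) ->
    trivIset [set` neighbors G x] F.
  by move=> FI u v _ _ [g [gu gv]]; exact: FI gu gv.
have N1 : N = \bigcup_(y in [set` neighbors G x]) cylinder [:: (x, y)].
  apply/seteqP; split=> [g gN|g [y /nbE xy gy]].
    exists (act g x); first exact/nbE.
    by move=> p; rewrite mem_seq1 => /eqP ->.
  by rewrite /N /=; have /= -> := gy (x, y) (mem_head _ _).
have N2 : N = \bigcup_(y in [set` neighbors G x]) cylinder [:: (y, x)].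
  apply/seteqP; split=> [g gN|g [y /nbE xy gy]].
    exists (act g^-1%g x); first by apply/nbE/adj_sym/(act_adj g); rewrite actVK.
    by move=> p; rewrite mem_seq1 => /eqP -> /=; rewrite actVK.
  have /= gyx := gy (y, x) (mem_head _ _).
  by rewrite /N /= -{1}gyx; apply/act_adj; exact: adj_sym.
apply: EFin_inj; rewrite EFinM -haar_weightE -sume_const_seq ?measure_ge0 // -sumEFin.
transitivity (mu N).
  rewrite N2 measure_fin_bigcup //.
  - rewrite fsbig_finite //= set_fsetK; apply: eq_bigr => y _.
    have [g gyx] := trans y x; rewrite (left_invariant_cylinder (g := g)) //=.
      by rewrite pstab1 haar_weightE.
    by move=> p; rewrite mem_seq1 => /eqP ->.
  - apply: disj => u v g gu gv; apply: (can_inj (actK g)).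
    by have /= -> := gu (u, x) (mem_head _ _); have /= -> := gv (v, x) (mem_head _ _).
  - by move=> y _; exact: measurable_cylinder.
rewrite N1 measure_fin_bigcup //.
- rewrite fsbig_finite //= set_fsetK; apply: eq_bigr => y _.
  have [g gxy] := trans x y; rewrite (left_invariant_cylinder (g := g)) //=.
    by rewrite pstab1.
  by move=> p; rewrite mem_seq1 => /eqP ->.
- apply: disj => u v g gu gv.
  by have /= <- := gu (x, u) (mem_head _ _); have /= <- := gv (x, v) (mem_head _ _).
- by move=> y _; exact: measurable_cylinder.
Qed.

(** A weight equal across all edges is constant by connectedness. *)
Lemma haar_weight_nonconst : ~ unimodular R T -> exists x y, adj G x y /\ m x <> m y.
Proof.
move=> nU; apply: contrapT => H; apply: nU; apply: (unimodular_of_const muH) => x y.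
rewrite !haar_weightE; congr (_%:E); have [p] := connG x y.
elim: p x => [|[ed w] p IH] x /=; first by move=> ->.
move=> [_ xw /IH <-]; apply: contrapT => xNw; apply: H; exists x, w; split=> //.
exact: edge_adj xw.
Qed.

End modular_function.

(** * Powers of the Haar weight *)

(** Strict concavity at 1: with [r = expR t], combine the strict tangent bounds of the exponential
    at [- (s * t)] and at [(1 - s) * t]. *)
Lemma powR_lt_tangent (R : realType) (r s : R) : 0 < r -> r != 1 -> 0 < s < 1 ->
  r `^ s < 1 + s * (r - 1).
Proof.
move=> r0 r1 /andP[s0 s1]; rewrite /powR gt_eqF //; set t := ln r.
have t0 : t != 0 by rewrite ln_eq0.
have -> : r = expR t by rewrite lnK.
have E1 : (1 - s * t) * expR (s * t) < 1.
  have : 1 + - (s * t) < expR (- (s * t)).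
    by apply: expR_gt1Dx; rewrite oppr_eq0 mulf_neq0 // gt_eqF.
  by rewrite expRN -ltr_pdivlMr ?expR_gt0 // div1r.
have E2 : (1 + (1 - s) * t) * expR (s * t) < expR t.
  have : 1 + (1 - s) * t < expR ((1 - s) * t).
    by apply: expR_gt1Dx; rewrite mulf_neq0 // subr_eq0 gt_eqF.
  rewrite -(ltr_pM2r (expR_gt0 (s * t))) -expRD.
  by rewrite -mulrDl subrK mul1r.
have s1' : 0 < 1 - s by rewrite subr_gt0.
(* [s * E2 + (1 - s) * E1]: the terms in [t] cancel. *)
have := ltrD (_ : (1 - s) * ((1 - s * t) * expR (s * t)) < (1 - s) * 1)
             (_ : s * ((1 + (1 - s) * t) * expR (s * t)) < s * expR t).
rewrite !ltr_pM2l // => /(_ E1 E2).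
rewrite !mulrA -mulrDl mulrBr mulrDr !mulr1 [s * ((1 - s) * t)]mulrCA.
rewrite addrACA [- _ + _]addrC subrr addr0 subrK mul1r => /lt_le_trans; apply.
by rewrite mulrBr mulr1 addrA addrAC.
Qed.

Section eigenfunction.
Variables (R : realType) (V : choiceType) (G : sgraph V) (Gamma : closed_subgroup G).
Hypotheses (lfG : locally_finite G) (trans : transitive_on_vertices Gamma).
Variable m : V -> R.
Hypotheses (m_gt0 : forall x, 0 < m x)
  (m_act : forall (g : csg Gamma) x y, m x * m (act g y) = m y * m (act g x))
  (m_harmonic : forall x, \sum_(y <- neighbors G x) m y = #|` neighbors G x|%:R * m x)
  (m_nonconst : exists x y, adj G x y /\ m x <> m y).

Lemma neighbors_act (g : csg Gamma) x :
  perm_eq (neighbors G (act g x)) (map (act g) (neighbors G x)).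
Proof.
apply: uniq_perm; rewrite ?fset_uniq ?map_inj_uniq ?fset_uniq //.
  exact: can_inj (actK g).
move=> y; rewrite in_neighbors //; apply/asboolP/mapP => [xy|[z + ->]].
  exists (act g^-1%g y); last by rewrite actVK.
  by rewrite in_neighbors //; apply/asboolP/(act_adj g); rewrite actVK.
by rewrite in_neighbors // => /asboolP xz; exact/act_adj.
Qed.

Lemma degree_const x y : #|` neighbors G x| = #|` neighbors G y|.
Proof.
by have [g <-] := trans x y; rewrite (perm_size (neighbors_act g x)) size_map.
Qed.

(** The sum [rho] is constant by transitivity, which makes [m ^ s] an eigenfunction. The tangent
    inequality, strict at a neighbour of different weight, gives [rho < d]. *)
Lemma power_eigenfunction (s : R) : 0 < s < 1 -> exists2 kappa : R, 0 < kappa &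
  forall x, \sum_(y <- neighbors G x) m y `^ s =
    (#|` neighbors G x|%:R - kappa) * m x `^ s.
Proof.
move=> s01; have [x0 [y0 [xy0 mxy]]] := m_nonconst.
pose rho x := \sum_(y <- neighbors G x) (m y / m x) `^ s.
have rho_const x : rho x = rho x0.
  have [g <-] := trans x0 x; rewrite /rho (perm_big _ (neighbors_act g x0)) big_map.
  apply: eq_bigr => y _; congr (_ `^ s).
  have p := lt0r_neq0 (m_gt0 x0); have q := lt0r_neq0 (m_gt0 (act g x0)).
  by apply/eqP; rewrite eqr_div // mulrC m_act.
exists (#|` neighbors G x0|%:R - rho x0); last first.
  move=> x; rewrite (degree_const x x0) opprB addrC subrK -(rho_const x) mulr_suml.
  apply: eq_bigr => y _; rewrite -powRM ?divfK ?gt_eqF // ?ltW // divr_gt0 //.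
rewrite subr_gt0 -sum1_size natr_sum.
have weak (y : V) : (m y / m x0) `^ s <= 1 + s * (m y / m x0 - 1).
  have [->|r1] := eqVneq (m y / m x0) 1; first by rewrite powR1 subrr mulr0 addr0.
  by apply: ltW; apply: powR_lt_tangent => //; exact: divr_gt0.
have y0x0 : y0 \in neighbors G x0 by rewrite in_neighbors //; exact/asboolP.
have strict : \sum_(y <- neighbors G x0) (m y / m x0) `^ s <
    \sum_(y <- neighbors G x0) (1 + s * (m y / m x0 - 1)).
  rewrite (big_fsetD1 y0) //= [ltRHS](big_fsetD1 y0) //= ltr_leD //.
    apply: powR_lt_tangent => //; first exact: divr_gt0.
    by apply: contra_not_neq mxy => E; rewrite -[LHS]mul1r -E divfK // gt_eqF.
  by apply: ler_sum => y _.
(* The linear terms cancel because [m] is harmonic. *)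
apply: lt_le_trans strict _; rewrite big_split /= [X in _ + X](_ : _ = 0) ?addr0 //.
rewrite -mulr_sumr sumrB -mulr_suml m_harmonic mulfK ?gt_eqF //.
by rewrite big_const_seq count_predT iter_addr addr0 subrr mulr0.
Qed.

End eigenfunction.

(** * Uniform spanning trees *)

Lemma ler_sum_fsubset (R : numDomainType) (I : choiceType) (A B : {fset I}) (F F' : I -> R) :
  (A `<=` B)%fset -> (forall i, i \in A -> F i <= F' i) ->
  (forall i, i \in B -> 0 <= F' i) -> \sum_(i <- A) F i <= \sum_(i <- B) F' i.
Proof.
move=> AB FF' F0; apply: (@le_trans _ _ (\sum_(i <- A) F' i)).
  by rewrite big_seq [leRHS]big_seq; exact: ler_sum.
rewrite [leRHS](bigID (mem A)) /= -[leLHS]addr0; apply: lerD; last first.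
  by rewrite big_seq_cond; apply: sumr_ge0 => i /andP[/F0].
rewrite -[leRHS]big_filter (perm_big [seq i <- B | i \in A]) //=.
apply: uniq_perm; rewrite ?filter_uniq ?fset_uniq // => i.
by rewrite mem_filter; case: (boolP (i \in A)) => //= /(fsubsetP AB) ->.
Qed.

Section ust_bounds.
Variables (V : choiceType) (G : sgraph V).
Hypotheses (lfG : locally_finite G) (infV : infinite_set [set: V]).

(** A substitute for lying in the same tree that depends on finitely many edges only. *)
Definition joined_inside (S : {fset V}) (w : config G) (x y : V) : Prop :=
  joined (to_multigraph G) [set e | w e /\ (val e `<=` S)%fset] x y.

(* Unlike [joined_inside], this also allows the edges that leave [S]. *)
Definition joined_near (S : {fset V}) (w : config G) (x y : V) : Prop :=
  joined (to_multigraph G) [set e | w e /\ (val e `<=` closed_nbhd G S)%fset] x y.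

Section one_set.
Variable S : {fset V}.
Local Notation U := (closed_nbhd G S).
Local Notation interior := (@interior_vertex V G S).
Local Notation arel := (@adj_rel V G S).
Local Notation forest := (forest interior arel).

Lemma sum_neighbors (M : nmodType) (F : V -> M) (v : U) : val v \in S ->
  \sum_(u in [set u | arel v u]%SET) F (val u) = \sum_(y <- neighbors G (val v)) F y.
Proof.
move=> vS; rewrite -big_enum /= -(big_map val xpredT F); apply: perm_big.
apply: uniq_perm; rewrite ?fset_uniq ?map_inj_uniq ?enum_uniq //.
move=> y; apply/mapP/idP => [[u + ->]|].
  by rewrite mem_enum inE in_neighbors.
rewrite in_neighbors // => /asboolP vy; have yU := adj_nbhd lfG vS vy.
by exists [` yU]%fset => //; rewrite mem_enum inE; exact/asboolP.
Qed.

Lemma sum_interior (M : nmodType) (F : V -> M) :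
  \sum_(u in interior) F (val u) = \sum_(y <- S) F y.
Proof.
rewrite -big_enum /= -(big_map val xpredT F); apply: perm_big.
apply: uniq_perm; rewrite ?fset_uniq ?map_inj_uniq ?enum_uniq //.
move=> y; apply/mapP/idP => [[u + ->]|yS]; first by rewrite mem_enum.
by exists [` sub_nbhd G yS]%fset => //; rewrite mem_enum.
Qed.

(** Each edge of the walk is the outgoing edge of one of its ends and both ends lie in [S], so they
    coalesce. *)
Lemma joined_inside_coalesce (S0 : {fset V}) f (u v : U) : (S0 `<=` S)%fset -> f \in forest ->
  val u \in S -> joined_inside S0 (forest_tree f) (val u) (val v) -> coalesce interior f u v.
Proof.
move=> S0S ff uS [p]; elim: p u uS => [|[e w] p IH] u uS /=.
  by move=> /val_inj <-; exact: coalesce_refl.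
move=> [[/forest_treeP[a aS ea] eS0] eu wv].
have wS : w \in S.
  by apply: (fsubsetP S0S); apply: (fsubsetP eS0); rewrite eu fset22.
pose w' : U := [` sub_nbhd G wS]%fset.
apply: (@coalesce_trans _ _ _ _ w'); last exact: (IH w').
have [[au fw]|[aw fu]] := fset2_eq (etrans (esym ea) eu).
  by apply: coalesce_step => //; apply: val_inj; rewrite -(val_inj au); exact: fw.
apply: coalesce_sym; apply: coalesce_step => //; apply: val_inj.
by have -> : w' = a by exact: val_inj.
Qed.

Lemma ust_mean_volume (R : realType) (h : V -> R) (d : nat) (kappa : R)
    (S0 : {fset V}) x :
  (forall u, 0 < h u) -> 0 < kappa -> (forall u, #|` neighbors G u| = d) ->
  (forall u, \sum_(y <- neighbors G u) h y = (d%:R - kappa) * h u) ->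
  (S0 `<=` S)%fset -> x \in S ->
  ust_mean S (fun w : config G => \sum_(y <- S0) h y * (`[< joined_inside S0 w x y >])%:R)
    <= (d%:R / kappa) ^+ 2 * h x.
Proof.
move=> h0 k0 deg hS S0S xS; rewrite ust_meanE //.
(* Without forests the mean is zero, by the convention on division by zero. *)
have [F0|F0] := posnP #|forest|.
  by rewrite F0 invr0 mulr0 mulr_ge0 ?sqr_ge0 // ltW.
rewrite ler_pdivrMr ?ltr0n // mulrAC.
pose x' : U := [` sub_nbhd G xS]%fset.
have arel_sym : symmetric arel.
  by move=> u v; apply/asboolP/asboolP; exact: adj_sym.
have degS : {in interior, forall v, #|[set u | arel v u]%SET| = d}.
  move=> v vS; rewrite -(deg (val v)) -sum1_card -sum1_size.
  exact: (sum_neighbors (fun=> 1%N)).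
have hSS : {in interior, forall v : U, \sum_(u in [set u | arel v u]%SET) h (val u) =
    (d%:R - kappa) * h (val v)}.
  by move=> v vS; rewrite sum_neighbors.
have := @coalesce_volume_bound U interior arel R (h \o val) d kappa arel_sym
  (fun u => h0 (val u)) k0 degS hSS x' xS.
apply: le_trans; rewrite exchange_big /=.
pose F y := \sum_(f in forest) h y * (`[< joined_inside S0 (forest_tree f) x y >])%:R.
have F_ge0 y : 0 <= F y.
  by apply: sumr_ge0 => f _; rewrite mulr_ge0 ?ler0n // ltW.
apply: (@le_trans _ _ (\sum_(y <- S) F y)).
  by apply: ler_sum_fsubset.
rewrite -sum_interior; apply: ler_sum => u uS.
rewrite /F -mulr_sumr mulrC; apply: ler_wpM2r; first exact: ltW.
rewrite -natr_sum ler_nat /ncoalesce -sum1_card big_mkcond [leqRHS]big_mkcond /=.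
apply: leq_sum => f _; case: (boolP (f \in forest)) => // ff; case: asboolP => // J.
rewrite ifT //; apply/setIdP; split=> //.
exact: (@joined_inside_coalesce S0 f x' u S0S ff xS J).
Qed.

(** Follow the forest from [x] to the first vertex outside [S0]; every edge used starts in [S0]. *)
Lemma spanning_tree_escapes (S0 : {fset V}) (w : config G) x :
  (S0 `<=` S)%fset -> x \in S0 -> @spanning_trees V G S w ->
  exists2 y, y \notin S0 & joined_near S0 w x y.
Proof.
move=> S0S xS0 /(forest_tree_surj lfG infV)[f ff <-].
have main n (u z : U) : z \notin interior -> iter n f u = z -> val u \in S0 ->
    exists2 y, y \notin S0 & joined_near S0 (forest_tree f) (val u) y.
  move=> zS; elim: n u => [|n IH] u.
    by move=> /= -> /(fsubsetP S0S) zS'; rewrite inE zS' in zS.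
  rewrite iterSr => nz uS0; have uS := fsubsetP S0S _ uS0.
  have [fe _ _] := forestP _ _ _ ff; have /asboolP ufu := fe u uS.
  have [ed edE] := edge_exists ufu.
  have step : joined_near S0 (forest_tree f) (val u) (val (f u)).
    apply: (@joined_edge _ _ _ _ ed) => //; split; first by apply/forest_treeP; exists u.
    rewrite edE; apply/fsubsetP => a /fset2P[] ->; first exact: sub_nbhd.
    exact: adj_nbhd uS0 ufu.
  have [fS0|fS0] := boolP (val (f u) \in S0); last by exists (val (f u)).
  have [y yS0 uy] := IH _ nz fS0; exists y => //.
  exact: joined_trans uy.
have xS := fsubsetP S0S _ xS0; pose x' : U := [` sub_nbhd G xS]%fset.
have [_ _ fr] := forestP _ _ _ ff; have [z zS /reachP[n nz]] := fr x' xS.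
exact: (main n x' z).
Qed.

End one_set.
End ust_bounds.

(** * The infinite-volume limit *)

Section local_functions.
Variables (V : choiceType) (G : sgraph V).

(** Such functions are continuous, so bounded real-valued ones pass to the weak limit. *)
Definition local (Y : Type) (S : {fset V}) (F : config G -> Y) : Prop :=
  forall w w', (forall e, (val e `<=` S)%fset -> w e = w' e) -> F w = F w'.

Lemma inside_edges_finite (S : {fset V}) : finite_set [set e : edge G | (val e `<=` S)%fset].
Proof.
have -> : [set e : edge G | (val e `<=` S)%fset] = val @^-1` [set` fpowerset S].
  by apply/seteqP; split=> e /=; rewrite fpowersetE.
apply: finite_preimage; last exact: finite_fset.
by move=> e e' _ _; exact: val_inj.
Qed.

Lemma open_local (Y : Type) (S : {fset V}) (F : config G -> Y) (A : set Y) :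
  local S F -> open (F @^-1` A).
Proof.
move=> FS; rewrite openE => w /= Fw.
have [s sE] := (finite_seqP _).1 (inside_edges_finite S).
apply/(@nbhs_prod_discrete (edge G) (fun=> bool) w); exists s => w' ww'.
rewrite /preimage /= (FS w' w) // => e eS; apply: ww'.
by have : [set` s] e by rewrite -sE.
Qed.

Lemma continuous_local (R : realType) (S : {fset V}) (F : config G -> R) :
  local S F -> continuous F.
Proof.
move=> FS w A; rewrite nbhsE => -[B [oB Bw] BA].
apply: filterS (open_nbhs_nbhs (conj (open_local B FS) Bw)) => w' /=; exact: BA.
Qed.

Lemma measurable_local (R : realType) (S : {fset V}) (F : config G -> R) :
  local S F -> measurable_fun [set: borel (config G)] F.
Proof.
move=> FS _ A _; rewrite setTI; apply: sub_sigma_algebra; exact: open_local FS.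
Qed.

End local_functions.

(** * Passing to the wired uniform spanning forest *)

Section wusf_limit.
Variables (R : realType) (V : choiceType) (G : sgraph V).
Variable P : probability (borel (config G)) R.
Variable V_ : nat -> {fset V}.
Hypotheses (exh : exhaustion G V_) (lfG : locally_finite G) (infV : infinite_set [set: V])
  (limP : forall f : config G -> R, continuous f -> bounded_fun f ->
      (fun n => ust_mean (V_ n) f) @ \oo --> Rintegral P setT f).
Variable x : V.

Lemma exhaustion_mono i j : (i <= j)%N -> (V_ i `<=` V_ j)%fset.
Proof.
have [Vs _ _] := exh; elim: j => [|j IH]; first by rewrite leqn0 => /eqP ->.
rewrite leq_eqVlt => /predU1P[->//|/IH]; move/fsubset_trans; apply; exact: Vs.
Qed.

Lemma exhaustion_eventually (S : {fset V}) :
  exists n0, forall n, (n0 <= n)%N -> (S `<=` V_ n)%fset.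
Proof.
have [_ Vc _] := exh.
suff main (s : seq V) : exists n0, forall n, (n0 <= n)%N -> forall y, y \in s -> y \in V_ n.
  by have [n0 H] := main S; exists n0 => n nn0; apply/fsubsetP; exact: H.
elim: s => [|y s [n0 IH]]; first by exists 0%N.
have [k yk] := Vc y; exists (maxn k n0) => n; rewrite geq_max => /andP[kn n0n] z.
rewrite in_cons => /predU1P[->|]; last exact: IH.
exact: fsubsetP (exhaustion_mono kn) _ yk.
Qed.

Lemma joined_inside_mono (S S' : {fset V}) (w : config G) y : (S `<=` S')%fset ->
  @joined_inside V G S w x y -> @joined_inside V G S' w x y.
Proof.
by move=> SS'; apply: joined_sub => e [we eS]; split=> //; exact: fsubset_trans SS'.
Qed.

Lemma joined_inside_eventually (w : config G) y : tree_containing w x y ->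
  exists n0, forall n, (n0 <= n)%N -> @joined_inside V G (V_ n) w x y /\ y \in V_ n.
Proof.
move=> [p]; suff main u : walk (to_multigraph G) (edge_set w) u p y ->
    (exists n0, forall n, (n0 <= n)%N -> @joined_inside V G (V_ n) w x u /\ u \in V_ n) ->
    exists n0, forall n, (n0 <= n)%N -> @joined_inside V G (V_ n) w x y /\ y \in V_ n.
  move=> xy; apply: main xy _; have [n0 H] := exhaustion_eventually [fset x]%fset.
  exists n0 => n /H; rewrite fsub1set => xn; split=> //; exact: joined_refl.
elim: p u => [|[e v] p IH] u /=; first by move=> ->.
move=> [we eu vy] [n0 H]; apply: IH vy _.
have [n1 H1] := exhaustion_eventually (val e).
exists (maxn n0 n1) => n; rewrite geq_max => /andP[/H[xu _] /H1 en]; split.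
  by apply: joined_trans xu _; exact: (@joined_edge _ _ _ _ e).
by apply: (fsubsetP en); rewrite (eu : val e = [fset u; v]%fset) fset22.
Qed.

Section volume.
Variable h : V -> R.
Hypothesis h_gt0 : forall y, 0 < h y.

(** Local functions that increase with [n] and dominate, in the limit, every finite partial sum of
    [h] over the tree. *)
Definition inside_volume n (w : config G) : R :=
  \sum_(y <- V_ n) h y * (`[< @joined_inside V G (V_ n) w x y >])%:R.

Lemma inside_volume_ge0 n w : 0 <= inside_volume n w.
Proof. by apply: sumr_ge0 => y _; rewrite mulr_ge0 ?ler0n // ltW. Qed.

Lemma local_inside_volume n : local (V_ n) (inside_volume n).
Proof.
move=> w w' ww'; apply: eq_bigr => y _; congr (_ * (nat_of_bool _)%:R).
by apply/asboolP/asboolP; apply: joined_sub => e [we en]; split=> //;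
  rewrite ?ww' // -ww'.
Qed.

Lemma inside_volume_le n w : inside_volume n w <= \sum_(y <- V_ n) h y.
Proof.
apply: ler_sum => y _; case: asboolP => _; first by rewrite mulr1.
by rewrite mulr0 ltW.
Qed.

Lemma inside_volume_mono w : {homo (fun n => inside_volume n w) : i j / (i <= j)%N >-> i <= j}.
Proof.
move=> i j ij; apply: ler_sum_fsubset; first exact: exhaustion_mono.
  move=> y _; rewrite ler_pM2l // ler_nat; case: asboolP => // J.
  by rewrite asboolT //; apply: joined_inside_mono J; exact: exhaustion_mono.
by move=> y _; rewrite mulr_ge0 ?ler0n // ltW.
Qed.

Lemma inside_volume_sup w M : (forall n, inside_volume n w <= M) ->
  forall Y : {fset V}, [set` Y] `<=` tree_containing w x -> \sum_(y <- Y) h y <= M.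
Proof.
move=> volM Y YT.
have [n nP] : exists n, forall y, y \in Y -> @joined_inside V G (V_ n) w x y /\ y \in V_ n.
  suff main (s : seq V) : {subset s <= Y} -> exists n0, forall n, (n0 <= n)%N ->
      forall y, y \in s -> @joined_inside V G (V_ n) w x y /\ y \in V_ n.
    by have [//|n nP] := main Y; exists n; exact: nP.
  elim: s => [|y s IH] sY; first by exists 0%N.
  have [|n0 H0] := IH; first by move=> z zs; apply: sY; rewrite in_cons zs orbT.
  have [|n1 H1] := @joined_inside_eventually w y.
    by apply: YT; apply: sY; rewrite mem_head.
  exists (maxn n0 n1) => n; rewrite geq_max => /andP[nn0 nn1] z.
  by rewrite in_cons => /predU1P[->|]; [exact: H1 | exact: H0].
apply: le_trans (volM n); apply: ler_sum_fsubset.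
- by apply/fsubsetP => y /nP[].
- by move=> y /nP[J _]; rewrite asboolT // mulr1.
- by move=> y _; rewrite mulr_ge0 ?ler0n // ltW.
Qed.

Variable C : R.
Hypothesis mean_le : forall i j, (i <= j)%N -> x \in V_ j ->
  ust_mean (V_ j) (inside_volume i) <= C.

Lemma inside_volume_integral n : (\int[P]_w (inside_volume n w)%:E <= C%:E)%E.
Proof.
have mv := measurable_local (@local_inside_volume n).
pose B := \sum_(y <- V_ n) h y.
(* The limit concerns the real number [Rintegral], so finiteness of the integral comes first. *)
have lty : (\int[P]_w (inside_volume n w)%:E < +oo)%E.
  apply: (@le_lt_trans _ _ (\int[P]_w (cst B%:E w))%E).
    apply: ge0_le_integral => //.
    - by move=> w _; rewrite lee_fin inside_volume_ge0.
    - exact/measurable_EFinP.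
    - by move=> w _; rewrite lee_fin inside_volume_le.
  by rewrite integral_cst // [X in (_ * X)%E]probability_setT mule1 ltry.
rewrite -[leLHS]fineK; last first.
  by rewrite ge0_fin_numE // integral_ge0 // => w _; rewrite lee_fin inside_volume_ge0.
rewrite lee_fin; apply: (cvgr_to_le (limP (continuous_local (@local_inside_volume n)) _)).
  exists B; split; first exact: num_real.
  move=> M BM w _ /=; rewrite ger0_norm ?inside_volume_ge0 //.
  by apply: le_trans (inside_volume_le _ _) _; exact: ltW.
have [n0 H] := exhaustion_eventually [fset x]%fset.
exists (maxn n n0) => // j /=; rewrite geq_max => /andP[nj /H].
by rewrite fsub1set => xj; exact: mean_le.
Qed.

(** By monotone convergence the limit of [inside_volume n] has integral at most [C], hence is almost
    surely finite. *)
Lemma tree_volume_finite : {ae P, forall w, exists M, forall Y : {fset V},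
  [set` Y] `<=` tree_containing w x -> \sum_(y <- Y) h y <= M}.
Proof.
pose g n (w : borel (config G)) := (inside_volume n w)%:E.
have mg n : measurable_fun [set: borel (config G)] (g n).
  by apply/measurable_EFinP; exact: measurable_local (@local_inside_volume n).
have g0 n w : (0 <= g n w)%E by rewrite lee_fin inside_volume_ge0.
have gmono w : {homo g^~ w : i j / (i <= j)%N >-> (i <= j)%E}.
  by move=> i j ij; rewrite lee_fin inside_volume_mono.
have glim w : limn (g^~ w) = ereal_sup (range (g^~ w)).
  by apply/cvg_lim => //; exact: ereal_nondecreasing_cvgn.
have mlim : measurable_fun [set: borel (config G)] (fun w => limn (g^~ w)).
  apply: (emeasurable_fun_cvg g) => // w _; rewrite glim.
  exact: ereal_nondecreasing_cvgn.
have lim0 w : (0 <= limn (g^~ w))%E.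
  by rewrite glim; apply: le_trans (g0 0%N w) _; apply: ereal_sup_ubound; exists 0%N.
have int : P.-integrable [set: borel (config G)] (fun w => limn (g^~ w)).
  apply/integrableP; split=> //.
  under eq_integral => w _ do rewrite gee0_abs //.
  rewrite monotone_convergence //; apply: (@le_lt_trans _ _ C%:E); last exact: ltry.
  apply: lime_le; last by apply: nearW => n; exact: inside_volume_integral.
  apply: ereal_nondecreasing_is_cvgn => i j ij.
  by apply: ge0_le_integral => // w _; exact: gmono.
apply: filterS (integrable_ae measurableT int) => w /(_ I) fin.
exists (fine (limn (g^~ w))); apply: inside_volume_sup => n.
by rewrite -lee_fin fineK // glim; apply: ereal_sup_ubound; exists n.
Qed.

End volume.

Definition confined n : set (borel (config G)) :=
  [set w | forall y, y \notin V_ n -> ~ joined_near (V_ n) w x y].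

Lemma local_confined n : local (closed_nbhd G (V_ n)) (fun w => (confined n w : Prop)).
Proof.
move=> w w' ww'; apply/propext; split=> H y yn J; apply: (H y yn); apply: joined_sub J.
  by move=> e [we en]; split=> //; rewrite ww'.
by move=> e [we en]; split=> //; rewrite -ww'.
Qed.

(** By [spanning_tree_escapes] the event is impossible for the spanning trees over later [V_ j], and
    its indicator is local. *)
Lemma confined_null n : x \in V_ n -> P (confined n) = 0%E.
Proof.
move=> xn; have mc : measurable (confined n).
  by apply: sub_sigma_algebra; exact: (open_local [set Q : Prop | Q] (@local_confined n)).
pose f : config G -> R := \1_(confined n).
have lf : local (closed_nbhd G (V_ n)) f.
  move=> w w' /local_confined E; rewrite /f !indicE; congr (nat_of_bool _)%:R.
  by apply/idP/idP => /set_mem H; apply/mem_set; move: H; rewrite /= E.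
have f01 w : 0 <= f w <= 1 by rewrite /f indicE; case: (w \in _); rewrite ?lexx ?ler01.
have lim := limP (continuous_local lf) _.
have : Rintegral P setT f <= 0.
  apply: (cvgr_to_le (lim _)).
    exists 1; split; first exact: num_real.
    move=> M M1 w _ /=; have /andP[f0 f1] := f01 w; rewrite ger0_norm //.
    by apply: le_trans f1 _; exact: ltW.
  exists n => // j /= nj; rewrite ust_meanE // big1 ?mul0r // => w wf.
  rewrite /f indicE memNset // => /= H.
  have [y yn J] := spanning_tree_escapes lfG infV (exhaustion_mono nj) xn
    (forest_tree_spanning wf).
  exact: H yn J.
rewrite /Rintegral integral_indic // setIT => Pc.
have fin : P (confined n) \is a fin_num by exact: fin_num_measure.
by apply/eqP; rewrite eq_le measure_ge0 andbT -(fineK fin) lee_fin.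
Qed.

(** A finite tree would lie in some [V_ n], hence be confined to it. *)
Lemma tree_infinite : {ae P, forall w, infinite_set (tree_containing w x)}.
Proof.
have nc n : {ae P, forall w, x \in V_ n -> ~ confined n w}.
  have [xn|xn] := boolP (x \in V_ n); last by apply: nearW.
  exists (confined n); split; last by move=> w /= /not_implyP[_ /contrapT].
    by apply: sub_sigma_algebra; exact: (open_local [set Q : Prop | Q] (@local_confined n)).
  exact: confined_null.
apply: filterS (ae_foralln nc) => w H fin.
have [n0 H0] := exhaustion_eventually (x |` fset_set (tree_containing w x))%fset.
have /fsubsetP Tn := H0 n0 (leqnn _).
apply: (H n0); first by apply: Tn; rewrite !inE eqxx.
move=> y yn J; move/negP: yn; apply; apply: Tn.
rewrite in_fsetU in_fset_set //; apply/orP; right; apply/mem_set.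
by apply: joined_sub J => e [].
Qed.

End wusf_limit.

(** * Comparing sums of different powers *)

Section power_sums.
Variables (R : realType) (I : choiceType) (T : set I) (a : I -> R) (s M : R).
Hypotheses (a_gt0 : forall i, 0 < a i) (s_gt0 : 0 < s)
  (sumM : forall Y : {fset I}, [set` Y] `<=` T -> \sum_(i <- Y) a i `^ s <= M).

Lemma power_sum_pointwise i : T i -> a i `^ s <= M.
Proof.
move=> Ti; have := @sumM [fset i]%fset; rewrite big_seq_fset1; apply.
by move=> j /=; rewrite inE => /eqP ->.
Qed.

Lemma power_sum_ge0 : 0 <= M.
Proof.
by have := @sumM fset0; rewrite big_seq_fset0; apply => i /=; rewrite inE.
Qed.

Lemma power_split (l : R) i : a i `^ l = (a i `^ s) `^ (l / s).
Proof. by rewrite -powRrM mulrCA mulfV ?mulr1 // gt_eqF. Qed.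

(** Each [a i ^ s] is at most [M], so [a i ^ l] is at most [a i ^ s] times [M ^ (l / s - 1)]. *)
Lemma esum_power_lty (l : R) : s <= l -> (\esum_(i in T) (a i `^ l)%:E < +oo)%E.
Proof.
move=> sl; apply: (@le_lt_trans _ _ (M * M `^ (l / s - 1))%:E); last exact: ltry.
apply: ge_ereal_sup => _ [Y [Yfin YT] <-].
rewrite fsbig_finite //= sumEFin lee_fin.
have YE : [set` fset_set Y] `<=` T by rewrite fset_setK.
apply: le_trans (ler_wpM2r (powR_ge0 _ _) (sumM YE)); rewrite mulr_suml.
rewrite big_seq [leRHS]big_seq; apply: ler_sum => i; rewrite in_fset_set // => /set_mem Yi.
have t0 : 0 <= l / s - 1 by rewrite subr_ge0 ler_pdivlMr ?mul1r.
have aS0 : 0 < a i `^ s by exact: powR_gt0.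
have -> : a i `^ l = a i `^ s * (a i `^ s) `^ (l / s - 1).
  rewrite power_split -{2}(powRr1 (ltW aS0)) -powRD; first by rewrite addrC subrK.
  by rewrite (gt_eqF aS0) implybT.
rewrite ler_pM2l //.
apply: ge0_ler_powR; rewrite ?nnegrE ?powR_ge0 ?power_sum_ge0 //.
by apply: power_sum_pointwise; exact: YT.
Qed.

(** As [a] is bounded on [T], its power [l <= 0] is bounded below there by the positive constant
    [c], that is [M ^ (l / s)]. *)
Lemma esum_power_pinfty (l : R) : l <= 0 -> infinite_set T ->
  (\esum_(i in T) (a i `^ l)%:E = +oo)%E.
Proof.
move=> l0 infT; pose c := (M `^ (- l / s))^-1.
have [i0 Ti0] : T !=set0.
  apply: contrapT => nT; apply: infT; rewrite (_ : T = set0) // -subset0 => i Ti.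
  by case: nT; exists i.
have M0 : 0 < M by apply: lt_le_trans (power_sum_pointwise Ti0); exact: powR_gt0.
have c0 : 0 < c by rewrite invr_gt0 powR_gt0.
have ca i : T i -> c <= a i `^ l.
  move=> Ti; rewrite power_split -[l / s]opprK powRN -mulNr lef_pV2 ?posrE ?powR_gt0 //.
  apply: ge0_ler_powR; rewrite ?nnegrE ?powR_ge0 ?(ltW M0) ?power_sum_pointwise //.
  by rewrite divr_ge0 ?oppr_ge0 // ltW.
apply/eqyP => r r0; have [N Nr] : exists N : nat, r <= N%:R * c.
  exists (Num.truncn (r / c)).+1; rewrite -ler_pdivrMr //; apply: ltW.
  exact: truncnS_gt.
have [Y YT YN] := infinite_set_fset N infT.
apply: (@le_trans _ _ (\sum_(i <- Y) (a i `^ l)%:E)%E); last first.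
  apply: ereal_sup_ubound; exists [set` Y]; first by split=> //; exact: finite_fset.
  by rewrite fsbig_finite ?finite_fset //= set_fsetK.
rewrite sumEFin lee_fin; apply: le_trans Nr _.
apply: (@le_trans _ _ (\sum_(i <- Y) c)).
  by rewrite big_const_seq count_predT iter_addr addr0 -[leRHS]mulr_natl ler_pM2r ?ler_nat.
by rewrite big_seq [leRHS]big_seq; apply: ler_sum => i /YT; exact: ca.
Qed.

End power_sums.

Theorem proposition4p11 (R : realType) (V : choiceType) (G : sgraph V)
    (Gamma : closed_subgroup G)
    (mu : {measure set (borel (csg Gamma)) -> \bar R})
    (P : probability (borel (config G)) R) (x : V) (lambda : R) :
  locally_finite G -> connected_graph G -> infinite_set [set: V] ->
  transitive_on_vertices Gamma -> ~ unimodular R (csg Gamma) ->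
  left_haar mu -> wusf P ->
  (lambda <= 0 ->
    {ae P, forall w, tilted_volume mu (tree_containing w x) x lambda = +oo%E}) /\
  (0 < lambda ->
    {ae P, forall w, (tilted_volume mu (tree_containing w x) x lambda < +oo)%E}).
Proof.
move=> lfG connG infV trans nU muH [V_ exh limP].
(* The exhaustion by finite sets makes [V] countable. *)
have [e e_surj] : exists e : nat -> V, forall v, exists n, e n = v.
  have [_ Vc _] := exh.
  exists (fun k => let: (n, i) := odflt (0, 0)%N (choice.unpickle k : option (nat * nat)) in
    nth x (V_ n) i) => v.
  have [n vn] := Vc v; exists (choice.pickle (n, index v (V_ n))).
  by rewrite choice.pickleK /= nth_index.
pose m := haar_weight mu; have m0 := haar_weight_gt0 lfG connG e_surj muH.
(* [a y] is [Delta x y]. *)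
pose a y := m y / m x; have a0 y : 0 < a y by rewrite divr_gt0 ?m0.
have key (s : R) : 0 < s < 1 -> {ae P, forall w, exists M, forall Y : {fset V},
    [set` Y] `<=` tree_containing w x -> \sum_(y <- Y) a y `^ s <= M}.
  move=> s01.
  have [kappa k0 eig] := power_eigenfunction lfG trans m0
    (haar_weight_act lfG connG muH)
    (haar_weight_harmonic lfG connG muH trans)
    (haar_weight_nonconst lfG connG e_surj muH nU) s01.
  pose d := #|` neighbors G x|.
  have eig_a u : \sum_(y <- neighbors G u) a y `^ s = (d%:R - kappa) * a u `^ s.
    have aE y : a y `^ s = m y `^ s * (m x)^-1 `^ s.
      by rewrite powRM ?invr_ge0 // ltW ?m0.
    under eq_bigr do rewrite aE.
    by rewrite -mulr_suml eig aE mulrA -(degree_const lfG trans x u).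
  have h0 y : 0 < a y `^ s by exact: powR_gt0.
  apply: (tree_volume_finite exh limP h0 (C := (d%:R / kappa) ^+ 2 * a x `^ s)).
  move=> i j ij xj; apply: ust_mean_volume => //.
  - by move=> u; exact: (degree_const lfG trans u x).
  - exact: (exhaustion_mono exh).
have tv w : tilted_volume mu (tree_containing w x) x lambda =
  (\esum_(y in tree_containing w x) (a y `^ lambda)%:E)%E by [].
have FF : Filter (nbhs (almost_everywhere P)) by exact: ae_filter_ringOfSetsType.
split=> l0.
  have half : 0 < (2^-1 : R) < 1 by rewrite invr_gt0 ltr0n invf_lt1 ?ltr1n ?ltr0n.
  apply: filterS (filterI (key _ half) (tree_infinite exh lfG infV limP x)) => w [[M HM] inf].
  by rewrite tv; apply: (esum_power_pinfty a0 _ HM) => //; case/andP: half.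
(* An exponent in the range of [key] that does not exceed [lambda]. *)
pose s := Num.min lambda 2^-1.
have s01 : 0 < s < 1.
  rewrite lt_min gt_min l0 invr_gt0 ltr0n /=; apply/orP; right.
  by rewrite invf_lt1 ?ltr1n ?ltr0n.
apply: filterS (key _ s01) => w [M HM]; rewrite tv.
apply: (esum_power_lty a0 _ HM); first by case/andP: s01.
by rewrite ge_min lexx.
Qed.
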